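(* Let $d\ge1$. There is a constant $C_d$ depending only on $d$ such that the following holds. Let $\mu,\nu$ be probability measures on $\mathbb{R}^d$ supported on a set of diameter $1$, and let $\hat\mu_n,\hat\nu_n$ be empirical distributions of $n$ independent samples from $\mu$ and from $\nu$ respectively. For every $n\ge 1$ ($n\ge2$ if $d=4$), $$\mathbf{E}\big[|W_2^2(\hat\mu_n,\hat\nu_n)-W_2^2(\mu,\nu)|\big]\le C_d\times\begin{cases} n^{-2/d}&\text{if } d>4,\\ n^{-1/2}\log(n)&\text{if } d=4,\\ n^{-1/2}&\text{if } d<4.\end{cases}$$ Moreover, for all $t\ge0$ and $n\ge 1$, $$\mathbf{P}\Big[\big|W_2^2(\hat\mu_n,\hat\nu_n)-\mathbf{E}[W_2^2(\hat\mu_n,\hat\nu_n)]\big|\ge t\Big]\le 2\exp(-nt^2).$$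
   Context: $W_2^2(\mu,\nu)=\min_{\gamma\in\Pi(\mu,\nu)}\int\|y-x\|_2^2\,d\gamma(x,y)$, where $\Pi(\mu,\nu)$ is the set of couplings of $\mu$ and $\nu$. The empirical distributions are $\hat\mu_n=\frac1n\sum_{i=1}^n\delta_{x_i}$ and $\hat\nu_n=\frac1n\sum_{i=1}^n\delta_{y_i}$ with $x_1,\dots,x_n$ i.i.d. from $\mu$ and $y_1,\dots,y_n$ i.i.d. from $\nu$, all $2n$ samples being independent. The measures $\mu$ and $\nu$ are supported on the same set of diameter $1$. *)

(* Defs.v *)
From HB Require Import structures.
From mathcomp Require Import all_boot all_order all_algebra.
From mathcomp Require Import all_classical all_reals all_analysis.

Set Implicit Arguments.
Unset Strict Implicit.
Unset Printing Implicit Defensive.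

Import Order.TTheory GRing.Theory Num.Theory.
Import numFieldNormedType.Exports.

Local Open Scope classical_set_scope.
Local Open Scope ring_scope.

(* The space R^d is represented by [d.-tuple R]: the library equips it with the
   product of the Borel sigma-algebras of R, i.e. the Borel sigma-algebra
   of R^d. (The norm of ['rV[R]_d] is the sup norm and is not used.) *)

Definition l2dist (R : realType) (d : nat) (x y : d.-tuple R) : R :=
  Num.sqrt (\sum_(i < d) (tnth y i - tnth x i) ^+ 2).

(* The diameter of the empty set is -oo. *)
Definition diameter (R : realType) (d : nat) (S : set (d.-tuple R)) : \bar R :=
  ereal_sup [set (l2dist x y)%:E | x in S & y in S].

(* [S] need not be measurable. *)
Definition supported_on (R : realType) (d : nat)
    (mu : {measure set (d.-tuple R) -> \bar R}) (S : set (d.-tuple R)) : Prop :=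
  mu.-negligible (~` S).

(* The marginals are compared on measurable sets only: the value of a measure
   on a non-measurable set is irrelevant. *)
Definition couplings (R : realType) (d : nat)
    (mu nu : {measure set (d.-tuple R) -> \bar R}) :
    set (probability (d.-tuple R * d.-tuple R)%type R) :=
  [set g : probability (d.-tuple R * d.-tuple R)%type R |
    (forall A, measurable A -> pushforward g fst A = mu A) /\
    (forall A, measurable A -> pushforward g snd A = nu A)].

(* The squared 2-Wasserstein distance. The minimum over couplings is written as
   an infimum in [\bar R]. *)
Definition W2sq (R : realType) (d : nat)
    (mu nu : {measure set (d.-tuple R) -> \bar R}) : \bar R :=
  ereal_inf
    [set (\int[g]_z ((l2dist z.1 z.2) ^+ 2)%:E)%E | g in couplings mu nu].

Section empirical.
Context (R : realType) (d : nat) (n : nat) (x : 'I_n -> d.-tuple R).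
Local Open Scope ereal_scope.

Definition empirical (A : set (d.-tuple R)) : \bar R :=
  (n%:R^-1)%:E * \sum_(i < n) \d_(x i) A.

Let empirical0 : empirical set0 = 0.
Proof. by rewrite /empirical big1 ?mule0// => i _; rewrite measure0. Qed.

Let empirical_ge0 A : 0 <= empirical A.
Proof.
by rewrite /empirical mule_ge0 ?lee_fin ?invr_ge0// sume_ge0.
Qed.

Let empirical_sigma_additive : semi_sigma_additive empirical.
Proof.
move=> F mF tF mUF; rewrite /empirical.
rewrite [X in X @ \oo --> _](_ : _ = (fun k => (n%:R^-1)%:E *
    \sum_(0 <= j < k) \sum_(i < n) \d_(x i) (F j))); last first.
  by apply/funext => k; rewrite ge0_sume_distrr// => j _; exact: sume_ge0.
apply: cvgeZl => //.
rewrite [X in _ --> X](_ : _ =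
    lim ((fun k => \sum_(0 <= j < k) \sum_(i < n) \d_(x i) (F j)) @ \oo)).
  by apply: is_cvg_ereal_nneg_natsum => k _; exact: sume_ge0.
rewrite nneseries_sum//; apply: eq_bigr => /= i _.
exact: measure_semi_bigcup.
Qed.

HB.instance Definition _ := isMeasure.Build _ _ _ empirical
  empirical0 empirical_ge0 empirical_sigma_additive.

End empirical.

(* Every finite subfamily of the family [X] satisfies the product rule. *)
Definition mutually_independent (R : realType) (dO dT : measure_display)
    (Omega : measurableType dO) (T : measurableType dT)
    (P : probability Omega R) (I : finType) (X : I -> {RV P >-> T}) : Prop :=
  forall (J : {set I}) (A : I -> set T), (forall i, measurable (A i)) ->
    P (\bigcap_(i in [set` J]) (X i @^-1` A i)) =
    (\prod_(i in J) P (X i @^-1` A i))%E.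

Arguments mutually_independent {R dO dT Omega T} P {I} X.

Definition has_law (R : realType) (dO dT : measure_display)
    (Omega : measurableType dO) (T : measurableType dT)
    (P : probability Omega R) (X : {RV P >-> T})
    (mu : {measure set T -> \bar R}) : Prop :=
  forall A, measurable A -> distribution P X A = mu A.

Arguments has_law {R dO dT Omega T} P X mu.

(* The two samples put together, indexed by the disjoint union of their index
   sets. *)
Definition joint_family (n m : nat) (U : Type) (X : 'I_n -> U) (Y : 'I_m -> U)
    (k : 'I_n + 'I_m) : U :=
  match k with inl i => X i | inr j => Y j end.

Definition rate (R : realType) (d n : nat) : R :=
  if (4 < d)%N then n%:R `^ (- (2 / d%:R))
  else if d == 4%N then n%:R `^ (- (1 / 2)) * ln n%:R
  else n%:R `^ (- (1 / 2)).

(* Main.v *)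
Require Import Defs.
From HB Require Import structures.
From mathcomp Require Import all_boot all_order all_fingroup all_algebra.
From mathcomp Require Import all_classical all_reals all_analysis.
From mathcomp Require Import measurable_realfun.
From mathcomp Require Import ring lra zify.

(** The mean of the empirical cost is compared with [W2sq mu nu] by couplings
    only, without Kantorovich potentials.

    Averaging over the probability space the optimal matchings of the two
    samples gives a coupling of [mu] and [nu], so [W2sq mu nu] is at most the
    mean of the empirical cost.

    Conversely, let [(x_i, a_i)] and [(b_j, y_j)] be [2n] independent draws
    from a nearly optimal coupling of [mu] and [nu], so that the [x_i] and the
    [y_j] are the two samples. Since
    [|x - y|^2 = |x - a|^2 + |b - y|^2 - |b - a|^2 + 2 (x - b).(a - y)] and
    [4 (x - b).(a - y) <= |(x + a) - (b + y)|^2], every matching [s] gives, up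
    to the near-optimality error,
    [mean <= 2 W - E n^-1 sum_i |b_s(i) - a_i|^2 + E (2n)^-1 sum_i |z_i - z'_s(i)|^2]
    with [z = x + a] and [z' = b + y]. The first sum is again the cost of a
    coupling of [mu] and [nu], so its mean is at least [W]: the excess of the mean is at
    most half the squared distance between two independent samples of one law.
    That is quadratic in the distance, so matching the points cell by cell in
    a dyadic partition gives the rate [n^(-2/d)], and no smoothness or entropy
    estimate is needed.

    The deviation inequality is McDiarmid's: changing one of the [2n] points
    moves the empirical cost by at most [1/n]. *)

Set Implicit Arguments.
Unset Strict Implicit.
Unset Printing Implicit Defensive.

Import Order.TTheory GRing.Theory Num.Theory.
Import numFieldNormedType.Exports.

Local Open Scope ring_scope.

(** * Assignments and hierarchical matchings *)

(** For samples of equal size an optimal coupling can be taken to be a permutation. A random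
    coupling is then a random element of a finite set, so its measurability is elementary, and a
    permutation that depends on the samples still yields a coupling of [mu] and [nu] once it is
    averaged over indices and outcomes.

    The three rates come from one geometric series. At scale [2^-k] there are [2^(k d)] cells, their
    counts in two samples of size [n] differ in total by about [sqrt (n 2^(k d))], and an unmatched
    point costs about [4^-k]. This gives [n^(-1/2)] times a series of ratio [2^(d/2) / 4], for which
    [d = 4] is critical.

    An obstacle is that [S] may fail to be measurable and contains the samples only almost surely,
    whereas bounded differences require costs at most 1 everywhere. All points are therefore first
    sent into [S] by a measurable retraction that fixes almost every point.

    The constant in the deviation bound: [2n] coordinates of oscillation [1/n] have sum of squares
    [2/n], and McDiarmid's [exp (- 2 t^2 / (2/n))] is [exp (- n t^2)]. *)

Lemma exists_perm_cycle (I : finType) (s : I -> I) (i0 : I) :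
    s i0 != i0 -> (forall x, s x != x -> s (s x) != s x) ->
  exists2 t : {perm I}, (exists i, t i != i) &
    forall i, t i != i -> t i = s i /\ s i != i.
Proof.
move=> si0 ss; pose N := [set x | s x != x].
pose good (E : {set I}) := [&& E != finset.set0, E \subset N & s @: E \subset E].
have goodN : good N.
  apply/and3P; split=> //; first by apply/set0Pn; exists i0; rewrite inE.
  by apply/fintype.subsetP => _ /imsetP[x /[!inE] xN ->]; exact: ss.
(* For a minimal stable set [E] of moved points, [s @: E] is again such a set, so it has as many
   elements as [E]. Hence [s] is injective on [E], and it extends by the identity to a
   permutation. *)
case: (arg_minnP (fun E : {set I} => #|E|) goodN) => E /and3P[E0 EN sE] Emin.
have gsE : good (s @: E).
  apply/and3P; split; last exact: imsetS.
    by have /set0Pn[x xE] := E0; apply/set0Pn; exists (s x); exact: imset_f.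
  exact: fintype.subset_trans sE EN.
have sinj : {in E &, injective s}.
  by apply/imset_injP; rewrite eqn_leq leq_imset_card Emin.
pose t x := if x \in E then s x else x.
have tE x : x \in E -> s x \in E by move=> xE; apply: (fintype.subsetP sE); exact: imset_f.
have tinj : injective t.
  move=> x y; rewrite /t; case: ifPn => xE; case: ifPn => yE //.
  - exact: sinj.
  - by move=> e; move: yE; rewrite -e tE.
  - by move=> e; move: xE; rewrite e tE.
have NE x : x \in E -> s x != x by move=> /(fintype.subsetP EN); rewrite inE.
exists (perm tinj).
  by have /set0Pn[x xE] := E0; exists x; rewrite permE /t xE NE.
by move=> i; rewrite permE /t; case: ifPn => iE; [rewrite NE | rewrite eqxx].
Qed.

(* A circulation is a sum of cycles, removed one at a time: the support shrinks. *)
Lemma circulation_ge0 (R : realDomainType) (I : finType) (w A : I -> I -> R) :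
    (forall i, w i i = 0) -> (forall s : {perm I}, 0 <= \sum_i w i (s i)) ->
    (forall i j, 0 <= A i j) -> (forall i, \sum_j A i j = \sum_j A j i) ->
  0 <= \sum_i \sum_j A i j * w i j.
Proof.
move=> w0 ws.
have [m] := ubnP #|[set p : I * I | (p.1 != p.2) && (A p.1 p.2 != 0)]|.
elim: m A => // m IH A; rewrite ltnS => Am A0 bal.
have [/existsP[[i0 j0] /= /andP[ij0 Aij0]]|] :=
    boolP [exists p : I * I, (p.1 != p.2) && (A p.1 p.2 != 0)]; last first.
  move=> /existsPn noA; rewrite big1// => i _; rewrite big1// => j _.
  have [->|ij] := eqVneq i j; first by rewrite w0 mulr0.
  by have := noA (i, j); rewrite /= ij/= negbK => /eqP ->; rewrite mul0r.
(* A successor along an edge of nonzero mass; the value [i] itself signals that no edge leaves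
   [i]. *)
pose s i := odflt i [pick j | (j != i) && (A i j != 0)].
have sP i j : j != i -> A i j != 0 -> s i != i.
  rewrite /s; case: pickP => [k /andP[]//|/(_ j)/= + ji Aij].
  by rewrite ji Aij.
have sA i : s i != i -> A i (s i) != 0.
  by rewrite /s; case: pickP => [k /andP[]//|_ /=]; rewrite eqxx.
have ss x : s x != x -> s (s x) != s x.
  (* The edge from [x] makes the inflow of [y] positive; by balance so is its outflow, hence [y] has
     a successor too. *)
  move=> sx; have Ax := sA _ sx; set y := s x in sx Ax *.
  have : 0 < \sum_(j | j != y) A j y.
    rewrite (bigD1 x)/= 1?eq_sym// ltr_wpDr ?sumr_ge0//.
    by rewrite lt_neqAle eq_sym Ax A0.
  have -> : \sum_(j | j != y) A j y = \sum_(j | j != y) A y j.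
    by have := bal y; rewrite (bigD1 y)//= [RHS](bigD1 y)//= => /addrI.
  rewrite lt_neqAle eq_sym => /andP[] + _.
  have [/existsP[j /andP[jy Ayj]] _|/existsPn noj /negP[]] :=
    boolP [exists j, (j != y) && (A y j != 0)]; first exact: sP jy Ayj.
  rewrite big1// => j jy; have := noj j; rewrite jy/= negbK => /eqP //.
have [t [i1 ti1] tP] := exists_perm_cycle (sP i0 j0 (ltac:(by rewrite eq_sym)) Aij0) ss.
(* The least mass [mu] on the moved edges can be removed from all of them without making [A]
   negative, and it empties at least one edge. *)
case: (@Order.TotalTheory.arg_minP _ R I i1 (fun i => t i != i)
  (fun i => A i (t i)) ti1) => i2 ti2 Amin.
set mu := A i2 (t i2) in Amin.
have mu0 : 0 <= mu by exact: A0.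
(* The mass taken from the cycles goes to the diagonal, where [w] vanishes. This leaves all row and
   column sums unchanged, and the two terms cancel at the fixed points of [t]. *)
pose B i j := A i j - mu * (t i == j)%:R + mu * (i == j)%:R.
have AB i j : A i j = B i j + mu * (t i == j)%:R - mu * (i == j)%:R.
  by rewrite /B; ring.
have B0 i j : 0 <= B i j.
  rewrite /B; have [<-|ij] := eqVneq i j.
    by case: (t i == i); rewrite ?(mulr1, mulr0); have := A0 i i; lra.
  have [tij|tij] := eqVneq (t i) j; last by rewrite !mulr0 subr0 addr0.
  rewrite mulr1 mulr0 addr0 subr_ge0 -tij; apply: Amin.
  by rewrite tij eq_sym.
have sum1l (i : I) (F : I -> I -> R) f :
    \sum_j F i j * (f i == j)%:R = F i (f i).
  rewrite (bigD1 (f i))//= eqxx mulr1 big1 ?addr0// => j /negbTE.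
  by rewrite eq_sym => ->; rewrite mulr0.
have -> : \sum_i \sum_j A i j * w i j =
   \sum_i \sum_j B i j * w i j + mu * \sum_i w i (t i).
  rewrite mulr_sumr -big_split; apply: eq_bigr => i _ /=.
  transitivity (\sum_j (B i j * w i j + mu * (w i j * (t i == j)%:R)
     - mu * (w i j * (id i == j)%:R))).
    by apply: eq_bigr => j _; rewrite AB/=; ring.
  by rewrite sumrB big_split/= -!mulr_sumr !sum1l /= w0 mulr0 subr0.
rewrite addr_ge0 ?mulr_ge0//; apply: IH => //.
  apply: leq_trans Am; apply: proper_card; apply/properP; split.
    apply/fintype.subsetP => -[i j]; rewrite !inE/= => /andP[ij]; rewrite ij/=.
    apply: contraNN => /eqP Aij; apply/eqP; apply/le_anti; rewrite B0 andbT.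
    rewrite /B Aij (negbTE ij) mulr0 addr0 sub0r oppr_le0.
    by rewrite mulr_ge0.
  exists (i2, t i2); rewrite !inE/= eq_sym ti2/=.
    by have [-> si2] := tP _ ti2; exact: sA.
  by rewrite /B eqxx [i2 == _]eq_sym (negbTE ti2) mulr1 mulr0 addr0 subrr eqxx.
move=> i; rewrite /B !big_split/= bal !sumrN.
rewrite -!addrA; congr (_ + (- _ + _)); rewrite -!mulr_sumr; congr (_ * _).
  rewrite (bigD1 (t i))//= eqxx [RHS](bigD1 (t^-1 i)%g)//= permKV eqxx.
  rewrite !big1// => j ji; last by rewrite eq_sym (negbTE ji).
  by rewrite (can2_eq (permK t) (permKV t)) (negbTE ji).
by apply: eq_bigr => j _; rewrite eq_sym.
Qed.

(** The linear-programming side of Birkhoff's theorem, without extreme points. Relative to an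
    optimal permutation [s], the excess costs [w] have nonnegative sum along every permutation, and
    [P] with columns relabelled by [s] is a circulation because all its rows and columns sum to
    [r]. *)
Lemma assignment_ge (R : realDomainType) (I : finType) (c P : I -> I -> R)
    (r m : R) :
    (forall s : {perm I}, m <= \sum_i c i (s i)) -> (forall i j, 0 <= P i j) ->
    (forall i, \sum_j P i j = r) -> (forall j, \sum_i P i j = r) -> 0 <= r ->
  r * m <= \sum_i \sum_j P i j * c i j.
Proof.
move=> cm P0 Pr Pc r0.
case: (@Order.TotalTheory.arg_minP _ R _ 1%g xpredT
  (fun s : {perm I} => \sum_i c i (s i)) isT) => s _ smin.
pose w i j := c i (s j) - c i (s i); pose A i j := P i (s j).
have sumP (F : I -> R) : \sum_j F (s j) = \sum_j F j.
  by rewrite [RHS](reindex_inj (@perm_inj _ s)).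
have := @circulation_ge0 R I w A _ _ _ _.
have -> : \sum_i \sum_j A i j * w i j =
    \sum_i \sum_j P i j * c i j - r * \sum_i c i (s i).
  rewrite mulr_sumr -sumrB; apply: eq_bigr => i _.
  rewrite -(Pr i) -(sumP (fun j => P i j * c i j)) -(sumP (P i)) mulr_suml -sumrB.
  by apply: eq_bigr => j _; rewrite /A /w mulrBr.
rewrite subr_ge0 => h; apply: le_trans (h _ _ _ _).
- by rewrite ler_wpM2l.
- by move=> i; rewrite /w subrr.
- move=> t; rewrite /w sumrB subr_ge0.
  by have := smin (t * s)%g isT; under [leRHS]eq_bigr do rewrite permM.
- by move=> i j; exact: P0.
- by move=> i; rewrite /A (sumP (P i)) Pr Pc.
Qed.

Section tree_matching.
Context (R : realDomainType) (T : Type) (L : nat -> finType).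
Variables (cell : forall k, T -> L k) (K : nat) (a : nat -> R).
Hypothesis nested :
  forall k x y, cell k.+1 x = cell k.+1 y -> cell k x = cell k y.
Hypothesis a_gt0 : forall k, 0 < a k.

Definition tree_cost x y : R :=
  \sum_(k < K) a k * (cell k.+1 x != cell k.+1 y)%:R.

Lemma nested_le j k x y : (j <= k)%N -> cell k x = cell k y -> cell j x = cell j y.
Proof.
move=> /subnK <-; elim: (k - j)%N => // m IH /nested; exact: IH.
Qed.

(** At level [k.+1] the right side pays twice and the left at most once. At a level where [x] and
    [y] share a cell, equality of cells is transitive and the left pays no more; a level where they
    are separated is finer, so by nesting the right pays twice there. *)
Lemma tree_cost_swap (x x' y y' : T) (k : nat) : (k < K)%N ->
    cell k.+1 x = cell k.+1 y -> cell k.+1 x <> cell k.+1 y' ->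
    cell k.+1 x' <> cell k.+1 y ->
  tree_cost x y + tree_cost x' y' < tree_cost x y' + tree_cost x' y.
Proof.
move=> kK xy xy' x'y; rewrite /tree_cost -!big_split/=.
rewrite (bigD1 (Ordinal kK))//= [ltRHS](bigD1 (Ordinal kK))//=.
apply: ltr_leD.
  rewrite -!mulrDr ltr_pM2l// xy eqxx.
  have -> : cell k.+1 y != cell k.+1 y' by rewrite -xy; apply/eqP.
  have -> : cell k.+1 x' != cell k.+1 y by apply/eqP.
  by case: (cell k.+1 x' != _); rewrite -!natrD ltr_nat.
apply: ler_sum => l _; rewrite -!mulrDr ler_pM2l// -!natrD ler_nat.
have [xyl|/eqP xyl] := eqVneq (cell l.+1 x) (cell l.+1 y).
  rewrite xyl /= add0n.
  have [->|_] := eqVneq (cell l.+1 x') (cell l.+1 y).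
    by rewrite addn0.
  by rewrite addn1; case: (cell l.+1 x' != _).
have kl : (k.+1 <= l.+1)%N.
  by rewrite leqNgt; apply/negP => /ltnW lk; exact/xyl/(nested_le lk).
have -> : cell l.+1 x != cell l.+1 y'.
  by apply/eqP => /(nested_le kl).
have -> : cell l.+1 x' != cell l.+1 y.
  by apply/eqP => /(nested_le kl).
by case: (_ != _).
Qed.

(** In an optimal matching no cell both sends an [x] out and receives an [x] from outside for one of
    its [y]: exchanging the two partners would be cheaper. The pairs leaving a cell are thus at most
    its excess of [x] over [y], at all levels at once. *)
Lemma tree_matching (n : nat) (x y : 'I_n -> T) (s : {perm 'I_n}) :
    (forall t : {perm 'I_n}, \sum_i tree_cost (x i) (y (s i)) <=
                             \sum_i tree_cost (x i) (y (t i))) ->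
  \sum_i tree_cost (x i) (y (s i)) <=
  \sum_(k < K) a k * \sum_(Q : L k.+1)
    `| \sum_i ((cell k.+1 (x i) == Q)%:R - (cell k.+1 (y i) == Q)%:R) |.
Proof.
move=> smin; rewrite /tree_cost exchange_big/=; apply: ler_sum => k _.
rewrite -mulr_sumr ler_pM2l//.
(* Each separated pair is charged to one cell only, that of its [x]. *)
pose out (i : 'I_n) (Q : L k.+1) := (cell k.+1 (x i) == Q) && (cell k.+1 (y (s i)) != Q).
have -> : \sum_i (cell k.+1 (x i) != cell k.+1 (y (s i)))%:R =
    \sum_(Q : L k.+1) \sum_i (out i Q)%:R :> R.
  rewrite exchange_big/=; apply: eq_bigr => i _.
  rewrite (bigD1 (cell k.+1 (x i)))//= /out eqxx/= eq_sym big1 ?addr0// => Q.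
  by rewrite eq_sym => /negbTE ->.
apply: ler_sum => Q _.
have [/existsP[i iQ]|/existsPn noi] := boolP [exists i, out i Q]; last first.
  by rewrite big1 ?normr_ge0// => i _; rewrite (negbTE (noi i)).
have inQ j : cell k.+1 (y (s j)) == Q -> cell k.+1 (x j) == Q.
  move=> /eqP yj; apply/negPn/negP => xj; have /andP[/eqP xi yi] := iQ.
  have ij : i != j by apply/eqP => ij; rewrite -ij xi eqxx in xj.
  have := smin (tperm i j * s)%g; apply/negP; rewrite -ltNge.
  rewrite (bigD1 i)//= [ltRHS](bigD1 i)//= (bigD1 j) 1?eq_sym//=.
  rewrite [in ltRHS](bigD1 j) 1?eq_sym//= !permM tpermL tpermR !addrA.
  rewrite [X in _ + X < _](_ : _ = \sum_(l | (l != i) && (l != j))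
      tree_cost (x l) (y (s l))); last first.
    by apply: eq_bigr => l /andP[li lj]; rewrite permM tpermD// eq_sym.
  rewrite ltrD2r; apply: (tree_cost_swap (ltn_ord k)).
  - by rewrite xi yj.
  - by move=> e; move: yi; rewrite -e xi eqxx.
  - by move=> e; move: xj; rewrite e yj eqxx.
rewrite sumrB [X in _ <= `|_ - X|](reindex_inj (@perm_inj _ s))/= -sumrB.
apply: le_trans (ler_norm _); apply: ler_sum => j _; rewrite /out.
have := inQ j; case: (_ == Q) => [->//|_]; first by rewrite subrr.
by rewrite andbT subr0.
Qed.

End tree_matching.

(** Choosing by [pick] makes the result a function of the finitely many comparisons between total
    costs, which is what [measurable_optperm] exploits. The default is never reached, by
    [optpermP]. *)
Definition optperm (R : realDomainType) (I : finType) (c : I -> I -> R) : {perm I} :=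
  odflt 1%g [pick s : {perm I} |
    [forall t : {perm I}, \sum_i c i (s i) <= \sum_i c i (t i)]].

Lemma optpermP (R : realDomainType) (I : finType) (c : I -> I -> R) (t : {perm I}) :
  \sum_i c i (optperm c i) <= \sum_i c i (t i).
Proof.
rewrite /optperm; case: pickP => [s /forallP//|no].
case: (@Order.TotalTheory.arg_minP _ R _ 1%g xpredT
  (fun s : {perm I} => \sum_i c i (s i)) isT) => s _ smin.
by have /forallP[] := no s; move=> u; exact: smin.
Qed.

Local Open Scope classical_set_scope.
Local Open Scope ring_scope.

(** * Wasserstein distance of empirical measures *)

Definition sqd (R : realType) (d : nat) (x y : d.-tuple R) : R :=
  \sum_(i < d) (tnth y i - tnth x i) ^+ 2.

Section sqd_lemmas.
Context (R : realType) (d : nat).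
Implicit Types x y : d.-tuple R.

Lemma l2dist_sqr x y : l2dist x y ^+ 2 = sqd x y.
Proof. by rewrite sqr_sqrtr// sumr_ge0// => i _; rewrite sqr_ge0. Qed.

Lemma sqd_ge0 x y : 0 <= sqd x y.
Proof. by rewrite sumr_ge0// => i _; rewrite sqr_ge0. Qed.

Lemma measurable_sqd :
  measurable_fun [set: d.-tuple R * d.-tuple R] (fun z => sqd z.1 z.2).
Proof.
apply: measurable_sum => i; apply: measurable_funX.
by apply: measurable_funB; [apply: (measurableT_comp (measurable_tnth i) measurable_snd)
  |apply: (measurableT_comp (measurable_tnth i) measurable_fst)].
Qed.

Lemma measurable_sqd_comp dO (Omega : measurableType dO) (U V : Omega -> d.-tuple R) :
  measurable_fun setT U -> measurable_fun setT V ->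
  measurable_fun setT (fun w => sqd (U w) (V w)).
Proof.
by move=> mU mV; exact: (measurableT_comp measurable_sqd (measurable_fun_pair mU mV)).
Qed.

Lemma measurable_set1_tuple x : measurable [set x].
Proof.
have -> : [set x] = \bigcap_(i in [set: 'I_d]) ((@tnth _ _ ^~ i) @^-1` [set tnth x i]).
  apply/seteqP; split=> [_ ->//|y /= yx].
  by apply/eq_from_tnth => i; exact: yx.
apply: fin_bigcap_measurable => // i _; rewrite -[X in measurable X]setTI.
by apply: measurable_tnth.
Qed.

End sqd_lemmas.

Lemma mnormalize_unit d (T : measurableType d) (R : realType)
    (m : {measure set T -> \bar R}) (P : probability T R) (A : set T) :
  m setT = 1%E -> mnormalize m P A = m A.
Proof.
by move=> mT; rewrite /mnormalize/= mT onee_eq0/= invr1 mule1.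
Qed.

(** The average over [i] of the joint laws of [U i] and [V i] is a coupling with exactly the cost on
    the right. Only the averaged marginals are prescribed, so the individual variables may have any
    law. *)
Lemma W2sq_le_average (R : realType) (d n : nat) (dO : measure_display)
    (Omega : measurableType dO) (P : probability Omega R)
    (U V : 'I_n.+1 -> Omega -> d.-tuple R)
    (mu nu : {measure set (d.-tuple R) -> \bar R}) :
    (forall i, measurable_fun setT (U i)) ->
    (forall i, measurable_fun setT (V i)) ->
    mu setT = 1%E ->
    (forall A, measurable A ->
      ((n.+1%:R^-1)%:E * \sum_(i < n.+1) P (U i @^-1` A) = mu A)%E) ->
    (forall A, measurable A ->
      ((n.+1%:R^-1)%:E * \sum_(i < n.+1) P (V i @^-1` A) = nu A)%E) ->
  (W2sq mu nu <=
   \int[P]_w (n.+1%:R^-1 * \sum_(i < n.+1) sqd (U i w) (V i w))%:E)%E.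
Proof.
move=> mU mV mu1 Umu Vnu.
have mUV k : measurable_fun setT (fun w => (U (inord k) w, V (inord k) w)).
  exact: measurable_fun_pair.
pose UV k : {mfun Omega >-> (d.-tuple R * d.-tuple R)%type} :=
  HB.pack (fun w => (U (inord k) w, V (inord k) w))
    (isMeasurableFun.Build _ _ _ _ _ (mUV k)).
have r0 : 0 <= n.+1%:R^-1 :> R by rewrite invr_ge0.
pose m : {measure set (d.-tuple R * d.-tuple R) -> \bar R} :=
  mscale (NngNum r0) (msum (fun k => distribution P (UV k)) n.+1).
(* [m] already has mass 1; normalising only equips it with the structure of a probability. *)
pose g : probability _ R := mnormalize m (dirac (point : d.-tuple R * d.-tuple R)).
have mE A : m A = ((n.+1%:R^-1)%:E * \sum_(i < n.+1)
    P ((fun w => (U i w, V i w)) @^-1` A))%E.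
  rewrite /m /mscale/=; congr (_ * _)%E; apply: eq_bigr => i _.
  transitivity (P ((fun w => (U (inord i) w, V (inord i) w)) @^-1` A)) => //.
  by rewrite inord_val.
have mT : m setT = 1%E by rewrite mE -mu1 -Umu.
have gm A : g A = m A by exact: mnormalize_unit.
have gc : couplings mu nu g.
  split=> A mA; rewrite /pushforward gm mE.
  - by rewrite -Umu.
  - by rewrite -Vnu.
apply: le_trans.
  by apply: ereal_inf_lbound; exists g; [exact: gc|reflexivity].
under eq_integral do rewrite l2dist_sqr.
rewrite (eq_measure_integral m)/=; last by move=> A mA _; exact: gm.
have ms : measurable_fun setT (fun z : d.-tuple R * d.-tuple R => (sqd z.1 z.2)%:E).
  by apply/measurable_EFinP; exact: measurable_sqd.
have mUVi i : measurable_fun [set: Omega] (fun x => (sqd (U i x) (V i x))%:E).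
  by apply/measurable_EFinP; exact: measurable_sqd_comp.
rewrite ge0_integral_mscale//; last by move=> z _; rewrite lee_fin sqd_ge0.
rewrite ge0_integral_measure_sum//; last by move=> z _; rewrite lee_fin sqd_ge0.
under [leRHS]eq_integral do rewrite EFinM -sumEFin.
rewrite ge0_integralZl//; last 2 first.
- by apply: emeasurable_sum.
- by move=> w _; rewrite sume_ge0// => i _; rewrite lee_fin sqd_ge0.
rewrite ge0_integral_sum//; last by move=> i w _; rewrite lee_fin sqd_ge0.
rewrite le_eqVlt; apply/orP; left; apply/eqP; congr (_ * _)%E.
apply: eq_bigr => i _; rewrite ge0_integral_pushforward//; last first.
  by move=> z _; rewrite lee_fin sqd_ge0.
by rewrite preimage_setT; apply: eq_integral => w _ /=; rewrite inord_val.
Qed.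

Lemma probability_setI_full d (T : measurableType d) (R : realType)
    (P : probability T R) (A B : set T) : measurable A -> measurable B ->
  P (~` B) = 0%E -> P (A `&` B) = P A.
Proof.
move=> mA mB B0; apply/eqP; rewrite eq_le; apply/andP; split.
  by apply: le_measure; rewrite ?inE//; exact: measurableI.
rewrite (measureDI P mA mB) setDE (subset_measure0 _ _ _ B0) ?add0e//.
- by apply: measurableI => //; exact: measurableC.
- exact: measurableC.
Qed.

Lemma integral_probability_cst d (T : measurableType d) (R : realType)
    (P : probability T R) (r : \bar R) : (\int[P]_w r = r)%E.
Proof.
transitivity (r * P setT)%E; first exact: integral_cst.
by rewrite probability_setT mule1.
Qed.

Lemma bounded_integrable d (T : measurableType d) (R : realType)
    (P : probability T R) (f : T -> R) (M : R) :
  measurable_fun setT f -> (forall x, `|f x| <= M) ->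
  P.-integrable setT (EFin \o f).
Proof.
move=> mf fM; apply: measurable_bounded_integrable => //.
  by rewrite (le_lt_trans (probability_le1 _ _)) ?ltry.
exists M; split; first exact: num_real.
by move=> K MK x _; apply: le_trans (fM x) (ltW MK).
Qed.

Section share.
Context (R : realType) (d n : nat).
Implicit Types (x y : 'I_n -> d.-tuple R).

(* The mass that a point [u] of the sample gives to the index [i]: repeated
   sample points share their mass equally. *)
Definition share x (i : 'I_n) (u : d.-tuple R) : R :=
  (u == x i)%:R / \sum_(j < n) (x j == x i)%:R.

Let mult_gt0 x i : 0 < \sum_(j < n) (x j == x i)%:R :> R.
Proof.
by rewrite (bigD1 i)//= eqxx ltr_pwDl// sumr_ge0.
Qed.

Lemma share_ge0 x i u : 0 <= share x i u.
Proof. by rewrite divr_ge0// ltW. Qed.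

Lemma sum_share x u : \sum_i share x i u = \1_(range x) u.
Proof.
rewrite indicE; have [/set_mem[i0 _ <-]|] := boolP (u \in range x).
  rewrite (eq_bigr (fun i => (x i == x i0)%:R / \sum_j (x j == x i0)%:R)).
    by rewrite -mulr_suml divff// gt_eqF// mult_gt0.
  move=> i _; rewrite /share eq_sym; case: eqP => [->//|].
  by rewrite !mul0r.
rewrite notin_setE => nx; rewrite big1// => i _; rewrite /share.
by case: eqP => [uxi|]; rewrite ?mul0r//; exfalso; apply: nx; exists i.
Qed.

Lemma share_le1 x i u : share x i u <= 1.
Proof.
apply: (@le_trans _ _ (\sum_i share x i u)).
  by rewrite (bigD1 i)//= lerDl sumr_ge0// => j _; exact: share_ge0.
by rewrite sum_share indicE lern1 leq_b1.
Qed.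

Lemma share_sqd x y i j u v :
  share x i u * share y j v * sqd (x i) (y j) = share x i u * share y j v * sqd u v.
Proof.
rewrite /share; have [->|_] := eqVneq u (x i); last by rewrite !mul0r.
by have [->//|_] := eqVneq v (y j); rewrite !(mul0r, mulr0).
Qed.

Lemma measurable_share x i : measurable_fun setT (share x i).
Proof.
apply: measurable_funM; last exact: measurable_cst.
rewrite (_ : (fun _ => _) = \1_[set x i]).
  by apply: measurable_indic; exact: measurable_set1_tuple.
by apply/funext => u; rewrite indicE in_set1.
Qed.

(** Almost surely [q z] lies in the range of [y], where the shares add up to 1. What remains is the
    mass of the point [x i], its multiplicity over [n], divided by the multiplicity. The projections
    [p] and [q] are parameters so that rows and columns are treated alike. *)
Lemma share_coupling_margin x y (g : probability (d.-tuple R * d.-tuple R)%type R)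
    (p q : d.-tuple R * d.-tuple R -> d.-tuple R) :
    measurable_fun setT p -> measurable_fun setT q ->
    (forall A, measurable A -> g (p @^-1` A) = empirical x A) ->
    (forall A, measurable A -> g (q @^-1` A) = empirical y A) ->
  forall i, \sum_j fine (\int[g]_z (share x i (p z) * share y j (q z))%:E)%E
            = n%:R^-1.
Proof.
move=> mp mq gx gy i.
have mrange : measurable (range y).
  have -> : range y = \bigcup_(j in [set: 'I_n]) [set y j].
    by apply/seteqP; split=> [_ [j _ <-]|u [j _ ->]]; exists j.
  by apply: fin_bigcup_measurable => // j _; exact: measurable_set1_tuple.
have mpre (h : d.-tuple R * d.-tuple R -> d.-tuple R) A : measurable_fun setT h -> measurable A ->
    measurable (h @^-1` A).
  by move=> mh mA; have := mh measurableT A mA; rewrite setTI.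
have ms j : measurable_fun setT (fun z => (share x i (p z) * share y j (q z))%:E).
  apply/measurable_EFinP/measurable_funM.
  - exact: measurableT_comp (measurable_share x i) mp.
  - exact: measurableT_comp (measurable_share y j) mq.
have sge0 j z : (0 <= (share x i (p z) * share y j (q z))%:E)%E.
  by rewrite lee_fin mulr_ge0 ?share_ge0.
set k : R := \sum_(j < n) (x j == x i)%:R.
have k0 : 0 < k := mult_gt0 x i.
have sumE : (\sum_j \int[g]_z (share x i (p z) * share y j (q z))%:E = (n%:R^-1)%:E)%E.
  rewrite -ge0_integral_sum//.
  under eq_integral => z _ do rewrite sumEFin -mulr_sumr sum_share.
  rewrite (eq_integral (fun z => (k^-1)%:E *
     (\1_((p @^-1` [set x i]) `&` (q @^-1` (range y))) z)%:E)%E); last first.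
    move=> z _; rewrite -EFinM indicI; congr (_%:E).
    rewrite /share -/k mulrAC mulrC; congr (_ * (_ * _)).
    by rewrite indicE; congr (nat_of_bool _)%:R; apply/eqP/idP => [e|/set_mem//]; exact/mem_set.
  have mI := measurableI _ _ (mpre _ _ mp (measurable_set1_tuple (x i)))
    (mpre _ _ mq mrange).
  have k1 : (0 <= (k^-1)%:E)%E by rewrite lee_fin invr_ge0 ltW.
  have mind : measurable_fun setT
      (\1_((p @^-1` [set x i]) `&` (q @^-1` (range y))) : _ -> R).
    exact: measurable_indic.
  rewrite ge0_integralZl//; last exact/measurable_EFinP.
  rewrite integral_indic// setIT.
  have gI : g ((p @^-1` [set x i]) `&` (q @^-1` (range y))) = g (p @^-1` [set x i]).
    have mxi := mpre _ _ mp (measurable_set1_tuple (x i)).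
    apply: probability_setI_full => //; first exact: mpre mq _.
    rewrite preimage_setC gy; last exact: measurableC.
    rewrite /empirical big1 ?mule0// => j _.
    by rewrite diracE memNset// => ny; apply: ny; exists j.
  transitivity ((k^-1)%:E * g (p @^-1` [set x i]))%E; first by rewrite -gI.
  rewrite gx; last exact: measurable_set1_tuple.
  rewrite /empirical muleCA (_ : \sum_(j < n) _ = k%:E)%E.
    by rewrite -!EFinM mulVf ?gt_eqF// mulr1.
  rewrite /k -sumEFin; apply: eq_bigr => j _; rewrite diracE.
  by rewrite in_set1.
apply/EFin_inj; rewrite -sumE -sumEFin; apply: eq_bigr => j _; rewrite fineK//.
rewrite ge0_fin_numE ?integral_ge0//.
apply: (@le_lt_trans _ _ (n%:R^-1)%:E); last exact: ltry.
rewrite -sumE (bigD1 j)//= leeDl// sume_ge0// => l _.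
exact: integral_ge0.
Qed.

End share.

Lemma W2sq_empirical (R : realType) (d n : nat) (x y : 'I_n.+1 -> d.-tuple R) :
  W2sq (empirical x) (empirical y) =
  (n.+1%:R^-1 *
   \sum_i sqd (x i) (y (optperm (fun i j => sqd (x i) (y j)) i)))%:E.
Proof.
set s := optperm _; apply/eqP; rewrite eq_le; apply/andP; split.
  have emp1 : empirical x [set: d.-tuple R] = 1%E.
    rewrite /empirical; under eq_bigr do rewrite diracT.
    by rewrite sumEFin sumr_const card_ord -EFinM mulVf.
  (* A matching is an average of constant variables, here over a Dirac probability space. *)
  apply: (le_trans (@W2sq_le_average R d n _ _
     (dirac (point : d.-tuple R))
     (fun i => cst (x i)) (fun i => cst (y (s i))) _ _ _ _ emp1 _ _)) => //.
  - move=> A mA; rewrite /empirical; congr (_ * _)%E.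
    rewrite [RHS](reindex_inj (@perm_inj _ s))/=; apply: eq_bigr => i _.
    by rewrite /= !diracE; congr (nat_of_bool _)%:R%:E; apply/idP/idP => /set_mem h; exact/mem_set.
  - set P0 := \d_(_); have P0T : P0 setT = 1%E by exact: diracT.
    rewrite (eq_integral (cst (n.+1%:R^-1 * \sum_i sqd (x i) (y (s i)))%:E))//.
    rewrite integral_cst//; set P0T' := (X in (_ * X)%E).
    by rewrite (_ : P0T' = 1%E) ?mule1//; exact: P0T.
apply: le_ereal_inf_tmp => _ [g [gx gy] <-].
(* The mass that [g] carries from index [i] to index [j]. Thanks to the shares its rows and columns
   sum to [n.+1%:R^-1] even when sample points coincide. *)
pose Pm i j : R := fine (\int[g]_z (share x i z.1 * share y j z.2)%:E)%E.
have mshare i j : measurable_fun setT (fun z : d.-tuple R * d.-tuple R =>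
    share x i z.1 * share y j z.2).
  apply: measurable_funM.
  - exact: measurableT_comp (measurable_share x i) measurable_fst.
  - exact: measurableT_comp (measurable_share y j) measurable_snd.
have intP i j : (\int[g]_z (share x i z.1 * share y j z.2)%:E = (Pm i j)%:E)%E.
  rewrite fineK//; apply: integrable_fin_num => //.
  apply: (@bounded_integrable _ _ _ _ _ 1) => // z.
  rewrite ger0_norm; last by rewrite mulr_ge0 ?share_ge0.
  by apply: mulr_ile1; rewrite ?share_ge0 ?share_le1.
have := @assignment_ge R _ (fun i j => sqd (x i) (y j)) Pm (n.+1%:R^-1) _
  (optpermP _) _ _ _ _.
rewrite -/s => le_s; apply: (@le_trans _ _ (\sum_i \sum_j Pm i j * sqd (x i) (y j))%:E).
  rewrite lee_fin; apply: le_s => //.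
  - by move=> i j; apply/fine_ge0/integral_ge0 => z _; rewrite lee_fin mulr_ge0 ?share_ge0.
  - by apply: share_coupling_margin.
  - move=> j; rewrite /Pm.
    under eq_bigr do under eq_integral do rewrite mulrC.
    by apply: (@share_coupling_margin _ _ _ y x).
under eq_integral do rewrite l2dist_sqr.
have msc i j : measurable_fun setT (fun z : d.-tuple R * d.-tuple R =>
    (share x i z.1 * share y j z.2 * sqd (x i) (y j))%:E).
  by apply/measurable_EFinP/measurable_funM => //; exact: measurable_cst.
have sc0 i j (z : d.-tuple R * d.-tuple R) :
    (0 <= (share x i z.1 * share y j z.2 * sqd (x i) (y j))%:E)%E.
  rewrite lee_fin mulr_ge0 ?sqd_ge0//; apply: mulr_ge0; exact: share_ge0.
have -> : (\sum_i \sum_j Pm i j * sqd (x i) (y j))%:E =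
    (\int[g]_z (\sum_i \sum_j
      (share x i z.1 * share y j z.2 * sqd (x i) (y j))%:E))%E.
  rewrite ge0_integral_sum//; last by move=> i z _; rewrite sume_ge0.
  rewrite -sumEFin; apply: eq_bigr => i _.
  rewrite ge0_integral_sum// -sumEFin; apply: eq_bigr => j _.
  rewrite EFinM -intP -ge0_integralZr//.
  - exact/measurable_EFinP.
  - by move=> z _; rewrite lee_fin mulr_ge0 ?share_ge0.
  - by rewrite lee_fin sqd_ge0.
  by move=> i; apply: emeasurable_sum.
apply: ge0_le_integral => //.
- by move=> z _; rewrite sume_ge0// => i _; rewrite sume_ge0.
- by apply: emeasurable_sum => i; apply: emeasurable_sum.
- by apply/measurable_EFinP; exact: measurable_sqd.
move=> z _; under eq_bigr do rewrite sumEFin.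
rewrite sumEFin lee_fin.
under eq_bigr do under eq_bigr do rewrite share_sqd.
under eq_bigr do rewrite -mulr_suml -mulr_sumr.
rewrite -!mulr_suml !sum_share -[leRHS]mul1r ler_wpM2r ?sqd_ge0// !indicE.

Qed.

(** * Hoeffding's lemma *)

Section hoeffding_scalar.
Context (R : realType).

(** Convexity from the tangent at [s * x], evaluated at 0 and at [x]: with weights [1 - s] and [s]
    the linear terms cancel. *)
Lemma expR_chord (s x : R) : 0 <= s <= 1 -> expR (s * x) <= 1 - s + s * expR x.
Proof.
move=> /andP[s0 s1].
have h1 : expR (s * x) * (1 - s * x) <= 1.
  have := expR_ge1Dx (- (s * x)); rewrite expRN => h.
  by rewrite mulrC -ler_pdivlMr ?expR_gt0// mul1r.
have h2 : expR (s * x) * (1 + (1 - s) * x) <= expR x.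
  rewrite [in leRHS](_ : x = s * x + (1 - s) * x); last by ring.
  by rewrite expRD ler_pM2l ?expR_gt0// expR_ge1Dx.
have := expR_gt0 (s * x); nra.
Qed.

Lemma ge0_derive_ge (f df : R -> R) (h : R) :
  (forall x : R, is_derive x (1 : R) f (df x)) -> (forall x, 0 <= x -> 0 <= df x) ->
  0 <= h -> f 0 <= f h.
Proof.
move=> fdf df0 h0.
have [|c] := @MVT_segment R f df 0 h h0 (fun x _ => fdf x).
  apply/continuous_subspaceT => x.
  by apply/differentiable_continuous/derivable1_diffP; have [] := fdf x.
rewrite in_itv/= subr0 => /andP[c0 _] fh.
by rewrite -subr_ge0 fh mulr_ge0// df0.
Qed.

(** The logarithm of the left side has derivative [q], and [q] has derivative [q (1 - q) <= 1/4];
    integrating twice from 0 gives [p h + h^2 / 8]. *)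
Lemma hoeffding_scalar_ge0 (p h : R) : 0 <= p <= 1 -> 0 <= h ->
  1 - p + p * expR h <= expR (p * h + h ^+ 2 / 8).
Proof.
move=> /andP[p0 p1] h0.
pose D x := 1 - p + p * expR x.
have D0 x : 0 < D x.
  rewrite /D; have := expR_gt0 x.
  by have [->|pn0] := eqVneq p 0; [lra|have : 0 < p by lra]; nra.
have dD (x : R) : is_derive x (1 : R) D (p * expR x).
  by rewrite /D; apply: is_derive_eq; rewrite add0r /GRing.scale/=; ring.
(* [q] is the tilted probability, whose derivative is the variance [q (1 - q)] *)
pose q x := 1 - (1 - p) * (D x)^-1.
have qE x : q x = p * expR x / D x.
  have Dx := lt0r_neq0 (D0 x); rewrite /q -[X in X - _](divff Dx) -mulrBl /D.
  by congr (_ / _); ring.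
pose dq x := (1 - p) * (D x ^- 2 * (p * expR x)).
have qq (x : R) : is_derive x (1 : R) q (dq x).
  have := is_deriveV (lt0r_neq0 (D0 x)) (dD x).
  move=> dV; rewrite /q /dq; apply: is_derive_eq.
  by rewrite /GRing.scale/=; ring.
have dqE x : dq x = q x * (1 - q x).
  rewrite {1}qE /dq /q subKr; field.
  exact: lt0r_neq0.
have q_le x : 0 <= x -> q x <= p + x / 4.
  move=> x0; pose f x := p + x / 4 - q x.
  have df (y : R) : is_derive y (1 : R) f (1 / 4 - dq y).
    by rewrite /f; apply: is_derive_eq; rewrite /GRing.scale/=; ring.
  have := @ge0_derive_ge f _ x df.
  rewrite /f/= mul0r addr0 => h1.
  have q0 : q 0 = p by rewrite /q /D expR0; field; lra.
  rewrite q0 subrr in h1; rewrite -subr_ge0; apply: h1 => // y y0; rewrite dqE.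
  by have := sqr_ge0 (q y - 1 / 2); nra.
pose f x := p * x + x ^+ 2 / 8 - ln (D x).
have df (y : R) : is_derive y (1 : R) f (p + y / 4 - q y).
  have := is_derive1_comp (is_derive1_ln (D0 y)) (dD y) => dl.
  rewrite /f; apply: is_derive_eq.
  rewrite /GRing.scale/= qE; field; exact: lt0r_neq0.
have := @ge0_derive_ge f _ h df.
have D1 : D 0 = 1 by rewrite /D expR0; ring.
rewrite /f/= D1 ln1 mulr0 expr0n mul0r addr0 subr0 => H.
rewrite -[leLHS](@lnK R) ?posrE ?D0// ler_expR -subr_ge0; apply: H => // y y0.
by rewrite subr_ge0 q_le.
Qed.

Lemma hoeffding_scalar (p h : R) : 0 <= p <= 1 ->
  1 - p + p * expR h <= expR (p * h + h ^+ 2 / 8).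
Proof.
move=> /andP[p0 p1]; have [h0|/ltW h0] := leP 0 h.
  by apply: hoeffding_scalar_ge0; rewrite ?p0.
(* Negative [h] reduces to the previous case by exchanging the two outcomes: replace [p], [h] by
   [1 - p], [- h] and multiply by [expR h]. *)
have /hoeffding_scalar_ge0 : 0 <= 1 - p <= 1 by apply/andP; split; lra.
move=> /(_ (- h)); rewrite oppr_ge0 => /(_ h0) H.
have {H} := ler_wpM2l (ltW (expR_gt0 h)) H.
rewrite -expRD mulrDr mulrCA -expRD subrr expR0 mulr1 [X in X <= _]addrC.
rewrite (_ : h + _ = p * h + h ^+ 2 / 8); last by ring.
by apply: le_trans; rewrite le_eqVlt; apply/orP; left; apply/eqP; ring.
Qed.

End hoeffding_scalar.

Section bounded_expectation.
Context d (T : measurableType d) (R : realType) (P : probability T R).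
Implicit Types f g : T -> R.

Lemma EFin_Rintegral f : P.-integrable setT (EFin \o f) ->
  (\int[P]_x (f x)%:E = (\int[P]_x f x)%:E)%E.
Proof. by move=> intf; rewrite fineK//; exact: integrable_fin_num. Qed.

Lemma Rintegral_probability_cst (r : R) : \int[P]_x r = r.
Proof. by rewrite /Rintegral integral_probability_cst. Qed.

Lemma Rintegral_affine (a b : R) f : P.-integrable setT (EFin \o f) ->
  \int[P]_x (a + b * f x) = a + b * \int[P]_x f x.
Proof.
move=> intf; rewrite RintegralD//; last first.
  by apply: (eq_integrable _ (fun x => b%:E * (EFin \o f) x)%E) => //; exact: integrableZl.
  exact: finite_measure_integrable_cst.
by rewrite Rintegral_probability_cst RintegralZl.
Qed.

(** Only the oscillation of [G] is assumed, as this is what bounded differences provide; the infimum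
    of [G] supplies the interval. Bounding the exponential by its chord there replaces [G] by a
    two-point variable of the same mean, the case of [hoeffding_scalar]. *)
Lemma hoeffding_mgf (G : T -> R) (c l : R) : 0 < c ->
    measurable_fun setT G -> (forall x y, `|G x - G y| <= c) ->
  (\int[P]_x (expR (l * (G x - \int[P]_y G y)))%:E <=
    (expR (l ^+ 2 * c ^+ 2 / 8))%:E)%E.
Proof.
move=> c0 mG Gc; set E := Rintegral _ _ _.
pose a := inf (range G).
have rG : range G !=set0 by exists (G point); exists point.
have lG x : a <= G x.
  apply: ge_inf; last by exists x.
  by exists (G point - c) => _ [y _ <-]; have := Gc point y; rewrite ler_norml; lra.
have Gu x : G x <= a + c.
  rewrite -lerBlDr; apply: lb_le_inf => // _ [y _ <-].
  by have := Gc x y; rewrite ler_norml; lra.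
have intG : P.-integrable setT (EFin \o G).
  apply: (@bounded_integrable _ _ _ _ _ (`|a| + c)) => // x.
  have := ler_norm a; have := ler_norm (- a); rewrite normrN => h1 h2.
  by have := lG x; have := Gu x; rewrite ler_norml => h3 h4; apply/andP; split; lra.
have aE : a <= E.
  rewrite -[a]Rintegral_probability_cst; apply: le_Rintegral => //.
  exact: finite_measure_integrable_cst.
have Ea : E <= a + c.
  rewrite -[a + c]Rintegral_probability_cst; apply: le_Rintegral => //.
  exact: finite_measure_integrable_cst.
pose e := expR (l * c); pose K := expR (- (l * (E - a))).
(* [A + B * g] is the chord of [expR (l * (g - E))] over the interval from [a] to [a + c]. *)
pose A := K * (1 - a / c * (e - 1)); pose B := K * ((e - 1) / c).
have pw x : expR (l * (G x - E)) <= A + B * G x.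
  have s01 : 0 <= (G x - a) / c <= 1.
    rewrite divr_ge0 ?subr_ge0//= ?ler_pdivrMr// ?mul1r ?lerBlDl//.
    exact: ltW.
  have := expR_chord (l * c) s01.
  rewrite (_ : l * (G x - E) = - (l * (E - a)) + (G x - a) / c * (l * c)); last first.
    by field; exact: lt0r_neq0.
  rewrite expRD -/K -/e => h.
  have := ler_wpM2l (expR_ge0 (- (l * (E - a)))) h.
  move=> /le_trans; apply.
  rewrite -/K /A /B le_eqVlt; apply/orP; left; apply/eqP; field.
  exact: lt0r_neq0.
have intAB : P.-integrable setT (EFin \o (fun x => A + B * G x)).
  apply: (@bounded_integrable _ _ _ _ _ (`|A| + `|B| * (`|a| + c))) => [|x].
    by apply: measurable_funD => //; exact: measurable_funM.
  rewrite (le_trans (ler_normD _ _))// lerD2l normrM ler_wpM2l//.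
  have := ler_norm a; have := ler_norm (- a); rewrite normrN => h1 h2.
  by have := lG x; have := Gu x; rewrite ler_norml => h3 h4; apply/andP; split; lra.
apply: (@le_trans _ _ (\int[P]_x (A + B * G x)%:E)%E).
  apply: ge0_le_integral => //.
  - apply/measurable_EFinP; apply: measurableT_comp => //.
    by apply: measurable_funM => //; exact: measurable_funB.
  - exact: measurable_int intAB.
  - by move=> x _; rewrite lee_fin; exact: pw.
rewrite EFin_Rintegral// Rintegral_affine// lee_fin.
have p01 : 0 <= (E - a) / c <= 1.
  rewrite divr_ge0 ?subr_ge0//= ?ler_pdivrMr// ?mul1r ?lerBlDl//.
  exact: ltW.
have := ler_wpM2l (expR_ge0 (- (l * (E - a)))) (hoeffding_scalar (l * c) p01).
rewrite -expRD [X in _ <= expR X](_ : _ = l ^+ 2 * c ^+ 2 / 8); last first.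
  by field; exact: lt0r_neq0.
apply: le_trans; rewrite -/K -/e /A /B -/E le_eqVlt; apply/orP; left; apply/eqP; field.
exact: lt0r_neq0.
Qed.

End bounded_expectation.

(** * Products of probability measures on tuples *)

Section tuple_product.
Context d (T : measurableType d) (R : realType).

Definition tuple_cons (m : nat) (p : T * m.-tuple T) : m.+1.-tuple T :=
  [tuple of p.1 :: p.2].

Lemma measurable_tuple_cons m : measurable_fun setT (@tuple_cons m).
Proof. by apply: measurable_cons. Qed.

HB.instance Definition _ m :=
  isMeasurableFun.Build _ _ _ _ (@tuple_cons m) (@measurable_tuple_cons m).

(** The factors may differ, since one half of the pooled sample follows [mu] and the other [nu].
    Splitting off the head makes integration one coordinate at a time, hence McDiarmid's induction,
    a direct use of Fubini. *)
Fixpoint tuple_product (m : nat) (mus : nat -> probability T R) :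
    probability (m.-tuple T) R :=
  match m with
  | 0 => dirac [tuple]
  | m'.+1 => distribution (mus 0%N \x tuple_product m' (fun k => mus k.+1))%E
               (@tuple_cons m')
  end.

Definition tuple_rect (m : nat) (A : 'I_m -> set T) : set (m.-tuple T) :=
  [set t | forall i, A i (tnth t i)].

Lemma measurable_tuple_rect m (A : 'I_m -> set T) :
  (forall i, measurable (A i)) -> measurable (tuple_rect A).
Proof.
move=> mA; have -> : tuple_rect A =
    \bigcap_(i in [set: 'I_m]) ((@tnth m T)^~ i @^-1` A i).
  by apply/seteqP; split=> t /= At i; [move=> _|]; exact: At.
apply: fin_bigcap_measurable => // i _.
by have := measurable_tnth i measurableT (mA i); rewrite setTI.
Qed.

Lemma tuple_product_rect m (mus : nat -> probability T R) (A : 'I_m -> set T) :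
  (forall i, measurable (A i)) ->
  (tuple_product m mus (tuple_rect A) = \prod_(i < m) mus i (A i))%E.
Proof.
elim: m mus A => [|m IH] mus A mA.
  rewrite big_ord0 /= diracE mem_set//.
  by case.
rewrite big_ord_recl/= /distribution /pushforward.
have -> : @tuple_cons m @^-1` tuple_rect A =
    A ord0 `*` tuple_rect (fun i => A (lift ord0 i)).
  apply/seteqP; split=> -[x t] /=.
    move=> At; split; first by have := At ord0; rewrite tnth0.
    by move=> i; have := At (lift ord0 i); rewrite tnthS.
  move=> [Ax At] i; have [j ->|->] := unliftP ord0 i; last by rewrite tnth0.
  by rewrite tnthS; exact: At.
rewrite product_measure1E//; last exact: measurable_tuple_rect.
by congr (_ * _)%E; exact: IH.
Qed.

Lemma tuple_measure_unique m (P Q : probability (m.-tuple T) R) :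
  (forall A : 'I_m -> set T, (forall i, measurable (A i)) ->
    P (tuple_rect A) = Q (tuple_rect A)) ->
  forall B, measurable B -> P B = Q B.
Proof.
move=> PQ.
pose G := [set B : set (m.-tuple T) | exists2 A : 'I_m -> set T,
  (forall i, measurable (A i)) & B = tuple_rect A].
have GT : G setT.
  by exists (fun=> setT) => //; apply/seteqP; split.
apply: (measure_unique G (fun=> setT)) => //.
- apply/seteqP; split.
    rewrite /measurable/=; apply: smallest_sub; first exact: smallest_sigma_algebra.
    move=> B; rewrite -bigcup_seq/= => -[i _ [A mA <-]].
    apply: sub_sigma_algebra; exists (fun j => if j == i then A else setT).
      by move=> j; case: ifP.
    apply/seteqP; split=> t /=.
      by move=> [_ At] j; case: eqP => [->|].
    by move=> /(_ i); rewrite eqxx.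
  apply: smallest_sub; first exact: sigma_algebra_measurable.
  by move=> _ [A mA ->]; exact: measurable_tuple_rect.
- move=> _ _ [A mA ->] [B mB ->]; exists (fun i => A i `&` B i).
    by move=> i; exact: measurableI.
  apply/seteqP; split=> t /=; first by move=> [At Bt] i; split.
  by move=> ABt; split=> i; have [] := ABt i.
- by rewrite bigcup_const//; exists 0%N.
- by move=> _ [A mA ->]; exact: PQ.
- by move=> _; rewrite (le_lt_trans (probability_le1 _ _)) ?ltry.
Qed.

Lemma ge0_integral_tuple_productS m (mus : nat -> probability T R)
    (f : m.+1.-tuple T -> \bar R) :
  measurable_fun setT f -> (forall t, 0 <= f t)%E ->
  (\int[tuple_product m.+1 mus]_t f t =
   \int[mus 0%N]_x \int[tuple_product m (fun k => mus k.+1)]_t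
      f (tuple_cons (x, t)))%E.
Proof.
move=> mf f0; rewrite /= ge0_integral_distribution//.
have mfc := measurableT_comp mf (@measurable_tuple_cons m).
rewrite fubini_tonelli1//.
by move=> x; exact: f0.
Qed.

Definition bounded_differences (m : nat) (F : m.-tuple T -> R) (c : R) : Prop :=
  forall (i : 'I_m) (t u : m.-tuple T),
    (forall j, j != i -> tnth t j = tnth u j) -> `|F t - F u| <= c.

(** McDiarmid's argument without conditional expectations. With the first coordinate [x] fixed, the
    mean [G x] over the others plays the part of the martingale: the induction hypothesis bounds the
    exponential moment of [F - G x] uniformly in [x], and [G] has oscillation at most [c], so
    Hoeffding's lemma handles [G - E]. *)
Lemma tuple_product_mgf m (mus : nat -> probability T R) (F : m.-tuple T -> R)
    (c M l : R) : 0 < c -> measurable_fun setT F -> (forall t, 0 <= F t <= M) ->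
    bounded_differences F c ->
  (\int[tuple_product m mus]_t
      (expR (l * (F t - \int[tuple_product m mus]_u F u)))%:E
   <= (expR (l ^+ 2 * (m%:R * c ^+ 2) / 8))%:E)%E.
Proof.
move=> c0; elim: m mus F => [|m IH] mus F mF FM Fc.
  have FE t : F t = F [tuple] by rewrite [t]tuple0.
  rewrite (eq_integral (cst 1%E)); last first.
    move=> t _; rewrite (FE t) /=.
    under eq_Rintegral do rewrite FE.
    by rewrite Rintegral_probability_cst subrr mulr0 expR0.
  by rewrite integral_probability_cst mul0r mulr0 mul0r expR0.
set Q := tuple_product m (fun k => mus k.+1).
pose Fx x (t : m.-tuple T) := F (tuple_cons (x, t)).
have mFc : measurable_fun setT (F \o @tuple_cons m).
  exact: (measurableT_comp mF (@measurable_tuple_cons m)).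
have mFx x : measurable_fun setT (Fx x) by exact: (measurable_fun_pair2 x mFc).
have Fxc x : bounded_differences (Fx x) c.
  move=> i t u tu; apply: (Fc (lift ord0 i)) => j ji.
  have [k jk|->] := unliftP ord0 j; last by rewrite /tuple_cons !tnth0.
  rewrite jk /tuple_cons !tnthS; apply: tu; apply: contra_neq ji => <-.
  by rewrite jk.
have iFx x : Q.-integrable setT (EFin \o Fx x).
  apply: (@bounded_integrable _ _ _ _ _ M) => // t.
  by have /andP[F0 F1] := FM (tuple_cons (x, t)); rewrite ger0_norm.
pose G x := \int[Q]_t Fx x t.
have GE x : (\int[Q]_t (F (tuple_cons (x, t)))%:E = (G x)%:E)%E.
  exact: EFin_Rintegral (iFx x).
have F0 t : (0 <= (F t)%:E)%E by rewrite lee_fin; case/andP: (FM t).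
have mG : measurable_fun setT G.
  apply: (measurableT_comp (@fine_measurable R setT measurableT)).
  apply: (@measurable_fun_fubini_tonelli_F _ _ _ _ R Q (EFin \o (F \o @tuple_cons m))).
    exact/measurable_EFinP.
  by move=> z; exact: F0.
have Gle x y : G x <= G y + c.
  rewrite addrC -[G y]mul1r -Rintegral_affine//.
  apply: le_Rintegral => //.
    apply: (@bounded_integrable _ _ _ _ _ (c + M)) => [|t].
      by apply: measurable_funD => //; exact: measurable_funM.
    have /andP[F1 F2] := FM (tuple_cons (y, t)).
    by rewrite mul1r ger0_norm ?addr_ge0 ?(ltW c0)// lerD2l.
  move=> t _; rewrite mul1r -lerBlDr.
  apply: (le_trans (ler_norm _)); apply: (Fc ord0) => j j0.
  have [k ->|jE] := unliftP ord0 j; last by rewrite jE eqxx in j0.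
  by rewrite /tuple_cons !tnthS.
have Gc x y : `|G x - G y| <= c.
  by rewrite ler_norml; have := Gle x y; have := Gle y x; lra.
set E := \int[_]_u F u.
have EE : E = \int[mus 0%N]_x G x.
  rewrite /E /Rintegral ge0_integral_tuple_productS//; last exact/measurable_EFinP.
  by congr fine; apply: eq_integral => x _; exact: GE.
have mexp (e : R) dS (S : measurableType dS) (f : S -> R) : measurable_fun setT f ->
    measurable_fun setT (fun t => (expR (l * (f t - e)))%:E).
  move=> mf; apply/measurable_EFinP; apply: measurableT_comp => //.
  by apply: measurable_funM => //; exact: measurable_funB.
have exp0 dS (S : measurableType dS) (f : S -> R) t : (0 <= (expR (f t))%:E)%E.
  by rewrite lee_fin expR_ge0.
rewrite ge0_integral_tuple_productS//; last exact: mexp.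
pose K := expR (l ^+ 2 * (m%:R * c ^+ 2) / 8).
have K0 : (0 <= K%:E)%E by rewrite lee_fin expR_ge0.
apply: (@le_trans _ _ (\int[mus 0%N]_x (K%:E * (expR (l * (G x - E)))%:E))%E).
  apply: ge0_le_integral => //.
  - by move=> x _; apply: integral_ge0 => t _; rewrite lee_fin expR_ge0.
  - apply: (@measurable_fun_fubini_tonelli_F _ _ _ _ R Q
      (fun z => (expR (l * (F (tuple_cons z) - E)))%:E)).
      exact: mexp.
    by move=> z; rewrite lee_fin expR_ge0.
  - by apply: emeasurable_funM => //; exact: mexp.
  move=> x _.
  rewrite (eq_integral (fun t => (expR (l * (G x - E)))%:E *
     (expR (l * (Fx x t - G x)))%:E)%E); last first.
    by move=> t _; rewrite -EFinM -expRD; congr (expR _)%:E; rewrite /Fx; ring.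
  rewrite ge0_integralZl//; last exact: mexp.
  rewrite muleC lee_wpmul2r//; apply: IH => // t.
  exact: FM.
rewrite ge0_integralZl//; last exact: mexp.
apply: (@le_trans _ _ (K%:E * (expR (l ^+ 2 * c ^+ 2 / 8))%:E)%E).
  by apply: lee_wpmul2l => //; rewrite EE; exact: hoeffding_mgf.
rewrite -EFinM -expRD lee_fin ler_expR -natr1 le_eqVlt; apply/orP; left; apply/eqP.
by field.
Qed.

End tuple_product.

Section independent_tuple.
Context d (T : measurableType d) (R : realType).

Lemma tuple_product_tnth m (mus : nat -> probability T R) (i : 'I_m) A :
  measurable A -> tuple_product m mus ((@tnth m T)^~ i @^-1` A) = mus i A.
Proof.
move=> mA; have -> : (@tnth m T)^~ i @^-1` A =
    tuple_rect (fun j => if j == i then A else setT).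
  apply/seteqP; split=> t /=; first by move=> At j; case: eqP => // ->.
  by move=> /(_ i); rewrite eqxx.
rewrite tuple_product_rect; last by move=> j; case: ifP.
rewrite (bigD1 i)//= eqxx big1 ?mule1// => j /negbTE ->.
exact: probability_setT.
Qed.

Lemma tuple_product_tnth2 m (mus : nat -> probability T R) (i j : 'I_m) A B :
  i != j -> measurable A -> measurable B ->
  (tuple_product m mus
     (((@tnth m T)^~ i @^-1` A) `&` ((@tnth m T)^~ j @^-1` B)) =
   mus i A * mus j B)%E.
Proof.
move=> ij mA mB; set S := _ `&` _.
have -> : S = tuple_rect (fun k => if k == i then A else if k == j then B else setT).
  apply/seteqP; split=> t /=.
    by move=> [At Bt] k; case: eqP => [->//|_]; case: eqP => // ->.
  move=> h; split; first by have := h i; rewrite eqxx.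
  by have := h j; rewrite eq_sym (negbTE ij) eqxx.
rewrite tuple_product_rect; last by move=> k; do 2?case: ifP.
have ji : j != i by rewrite eq_sym.
rewrite (bigD1 i)//= eqxx (bigD1 j)//= (negbTE ji) eqxx.
rewrite big1 ?mule1// => k /andP[/negbTE -> /negbTE ->].
exact: probability_setT.
Qed.

Context dO (Omega : measurableType dO) (P : probability Omega R).
Variables (m : nat) (Z : 'I_m -> Omega -> T) (mus : nat -> probability T R).
Hypothesis mZ : forall i, measurable_fun setT (Z i).
Hypothesis PZ : forall A : 'I_m -> set T, (forall i, measurable (A i)) ->
  P (\bigcap_(i in [set: 'I_m]) (Z i @^-1` A i)) = (\prod_(i < m) mus i (A i))%E.

Lemma measurable_sample : measurable_fun setT (fun w => [tuple Z i w | i < m]).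
Proof.
apply/measurable_fun_tnthP => i.
rewrite (_ : _ \o _ = Z i); first exact: mZ.
by apply/funext => w /=; rewrite tnth_mktuple.
Qed.

(** The product rule on rectangles determines the law of the whole sample; this is how statements
    over [Omega] are moved to a product space. *)
Lemma sample_law B : measurable B ->
  P ((fun w => [tuple Z i w | i < m]) @^-1` B) = tuple_product m mus B.
Proof.
pose Zm : {mfun Omega >-> m.-tuple T} := HB.pack (fun w => [tuple Z i w | i < m])
  (isMeasurableFun.Build _ _ _ _ _ measurable_sample).
move=> mB; transitivity (distribution P Zm B); first by [].
apply: tuple_measure_unique => // A mA.
rewrite tuple_product_rect// -PZ// /distribution /pushforward; congr (P _).
apply/seteqP; split=> w /=; first by move=> h i _; have := h i; rewrite tnth_mktuple.
by move=> h i; rewrite tnth_mktuple; exact: h.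
Qed.

Lemma sample_integral (f : m.-tuple T -> \bar R) :
  measurable_fun setT f -> (forall t, 0 <= f t)%E ->
  (\int[P]_w f [tuple Z i w | i < m] = \int[tuple_product m mus]_t f t)%E.
Proof.
pose Zm : {mfun Omega >-> m.-tuple T} := HB.pack (fun w => [tuple Z i w | i < m])
  (isMeasurableFun.Build _ _ _ _ _ measurable_sample).
move=> mf f0; transitivity (\int[distribution P Zm]_t f t)%E.
  by rewrite ge0_integral_distribution.
by apply: eq_measure_integral => A mA _; exact: sample_law.
Qed.

End independent_tuple.

(** * Measurability of random permutations *)

Section measurable_selection.
Context d (Omega : measurableType d).

Lemma measurable_select d' (S : measurableType d') (I : finType)
    (g : Omega -> I) (f : I -> Omega -> S) :
  (forall i, measurable (g @^-1` [set i])) ->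
  (forall i, measurable_fun setT (f i)) -> measurable_fun setT (fun w => f (g w) w).
Proof.
move=> mg mf _ A mA; rewrite setTI.
have -> : (fun w => f (g w) w) @^-1` A =
    \bigcup_(i in [set: I]) ((g @^-1` [set i]) `&` (f i @^-1` A)).
  apply/seteqP; split=> w /=; first by move=> Aw; exists (g w).
  by move=> [i _ [<-]].
apply: fin_bigcup_measurable => // i _; apply: measurableI => //.
by have := mf i measurableT A mA; rewrite setTI.
Qed.

(** The chosen permutation depends on [w] only through the table [b w] of minimality tests, which
    takes finitely many values, each on a measurable event. *)
Lemma measurable_optperm (R : realType) (I : finType) (c : I -> I -> Omega -> R)
    (s : {perm I}) : (forall i j, measurable_fun setT (c i j)) ->
  measurable ((fun w => optperm (fun i j => c i j w)) @^-1` [set s]).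
Proof.
move=> mc.
pose b w := [ffun s : {perm I} =>
  [forall t : {perm I}, \sum_i c i (s i) w <= \sum_i c i (t i) w]].
pose h (b : {ffun {perm I} -> bool}) := odflt 1%g [pick s | b s].
have -> : (fun w => optperm (fun i j => c i j w)) @^-1` [set s] =
    \bigcup_(b0 in [set b0 | h b0 = s]) (b @^-1` [set b0]).
  have hb w : optperm (fun i j => c i j w) = h (b w).
    by rewrite /optperm /h; congr (odflt _ _); apply: eq_pick => t; rewrite ffunE.
  apply/seteqP; split=> w /=; first by rewrite hb => hs; exists (b w).
  by move=> [b0 /= <- <-].
apply: fin_bigcup_measurable => [|b0 _].
  exact: finite_finset.
have -> : b @^-1` [set b0] = \bigcap_(t in [set: {perm I}]) [set w | b w t = b0 t].
  apply/seteqP; split=> w /=; first by move=> <-.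
  by move=> bw; apply/ffunP => t; exact: bw.
apply: fin_bigcap_measurable => [|t _]; first exact: finite_finset.
have mb : measurable_fun setT (fun w => b w t).
  apply: (measurable_fun_bool true).
  have -> : setT `&` (fun w => b w t) @^-1` [set true] =
      \bigcap_(u in [set: {perm I}])
        [set w | \sum_i c i (t i) w <= \sum_i c i (u i) w].
    rewrite setTI; apply/seteqP; split=> w /=; rewrite ffunE.
      by move=> /forallP h1 u _; exact: h1.
    by move=> h1; apply/forallP => u; exact: h1.
  apply: fin_bigcap_measurable => [|u _]; first exact: finite_finset.
  have := @measurable_fun_ler _ _ R setT (fun w => \sum_i c i (t i) w)
    (fun w => \sum_i c i (u i) w).
  move=> /(_ _ _ measurableT [set true]).
  rewrite setTI; apply => //; exact: measurable_sum.
by have := mb measurableT [set b0 t]; rewrite setTI; apply.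
Qed.

(** A permutation that depends on the sample may change the law of each selected term, but for every
    [w] it only reorders the sum of the indicators. *)
Lemma sum_measure_select (R : realType) (P : probability Omega R) (I : finType)
    (g : Omega -> {perm I}) (B : I -> set Omega) :
  (forall s, measurable (g @^-1` [set s])) -> (forall i, measurable (B i)) ->
  (\sum_i P [set w | B (g w i) w] = \sum_i P (B i))%E.
Proof.
move=> mg mB.
have mBg i : measurable_fun setT (fun w => \1_(B (g w i)) w : R).
  apply: (@measurable_select _ R _ g (fun s w => \1_(B (s i)) w : R) mg) => s.
  exact: measurable_indic.
have E1 i : P (B i) = (\int[P]_w (\1_(B i) w)%:E)%E.
  by rewrite integral_indic// setIT.
have E2 i : P [set w | B (g w i) w] = (\int[P]_w (\1_(B (g w i)) w)%:E)%E.
  rewrite (eq_integral (fun w => (\1_[set w | B (g w i) w] w)%:E)).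
    rewrite integral_indic// ?setIT//.
    have := mBg i measurableT [set 1] (measurable_set1 1); rewrite setTI.
    congr measurable; apply/seteqP; split=> w /=; rewrite indicE.
      by case: (boolP (w \in _)) => [/set_mem//|_ /eqP]; rewrite eq_sym oner_eq0.
    by move=> Bw; rewrite mem_set.
  by move=> w _; rewrite !indicE.
under eq_bigr do rewrite E2.
under [RHS]eq_bigr do rewrite E1.
have mB1 i : measurable_fun setT (fun w => (\1_(B i) w)%:E : \bar R).
  by apply/measurable_EFinP; exact: measurable_indic.
have mB2 i : measurable_fun setT (fun w => (\1_(B (g w i)) w)%:E : \bar R).
  exact/measurable_EFinP.
rewrite -!ge0_integral_sum//.
by apply: eq_integral => w _; rewrite [RHS](reindex_inj (@perm_inj _ (g w))).
Qed.

End measurable_selection.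

(** * Fluctuations of cell counts *)

Section bounded_measurable.
Context d (T : measurableType d) (R : realType).
Implicit Types f g : T -> R.

(** A class of integrands closed under the algebraic operations used below, so that integrability
    never has to be argued again. *)
Definition bounded_measurable f :=
  measurable_fun setT f /\ exists M, forall x, `|f x| <= M.

Lemma bounded_measurable_cst (r : R) : bounded_measurable (fun=> r).
Proof. by split; [exact: measurable_cst|exists `|r|]. Qed.

Lemma bounded_measurableD f g : bounded_measurable f -> bounded_measurable g ->
  bounded_measurable (fun x => f x + g x).
Proof.
move=> [mf [M fM]] [mg [N gN]]; split; first exact: measurable_funD.
by exists (M + N) => x; rewrite (le_trans (ler_normD _ _))// lerD.
Qed.

Lemma bounded_measurableM f g : bounded_measurable f -> bounded_measurable g ->
  bounded_measurable (fun x => f x * g x).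
Proof.
move=> [mf [M fM]] [mg [N gN]]; split; first exact: measurable_funM.
by exists (M * N) => x; rewrite normrM ler_pM.
Qed.

Lemma bounded_measurableN f : bounded_measurable f ->
  bounded_measurable (fun x => - f x).
Proof.
move=> [mf [M fM]]; split; first exact: measurable_funN.
by exists M => x; rewrite normrN.
Qed.

Lemma bounded_measurableB f g : bounded_measurable f -> bounded_measurable g ->
  bounded_measurable (fun x => f x - g x).
Proof.
by move=> bf bg; apply: bounded_measurableD => //; exact: bounded_measurableN.
Qed.

Lemma bounded_measurable_norm f : bounded_measurable f ->
  bounded_measurable (fun x => `|f x|).
Proof.
move=> [mf [M fM]]; split; first exact: measurableT_comp.
by exists M => x; rewrite normr_id.
Qed.

Lemma bounded_measurable_sum (I : Type) (s : seq I) (F : I -> T -> R) :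
  (forall i, bounded_measurable (F i)) ->
  bounded_measurable (fun x => \sum_(i <- s) F i x).
Proof.
move=> bF; elim: s => [|i s IH].
  under eq_fun do rewrite big_nil; exact: bounded_measurable_cst.
under eq_fun do rewrite big_cons; exact: bounded_measurableD.
Qed.

Lemma bounded_measurable_indic (A : set T) : measurable A ->
  bounded_measurable (\1_A : T -> R).
Proof.
move=> mA; split; first exact: measurable_indic.
by exists 1 => x; rewrite indicE ger0_norm// lern1 leq_b1.
Qed.

Context (P : probability T R).

Lemma bounded_measurable_integrable f : bounded_measurable f ->
  P.-integrable setT (EFin \o f).
Proof. by move=> [mf [M fM]]; exact: bounded_integrable fM. Qed.

Lemma RintegralD_bounded f g : bounded_measurable f -> bounded_measurable g ->
  \int[P]_x (f x + g x) = \int[P]_x f x + \int[P]_x g x.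
Proof. by move=> bf bg; rewrite RintegralD//; exact: bounded_measurable_integrable. Qed.

Lemma RintegralB_bounded f g : bounded_measurable f -> bounded_measurable g ->
  \int[P]_x (f x - g x) = \int[P]_x f x - \int[P]_x g x.
Proof. by move=> bf bg; rewrite RintegralB//; exact: bounded_measurable_integrable. Qed.

Lemma RintegralZ_bounded r f : bounded_measurable f ->
  \int[P]_x (r * f x) = r * \int[P]_x f x.
Proof. by move=> bf; rewrite RintegralZl//; exact: bounded_measurable_integrable. Qed.

Lemma le_Rintegral_bounded f g : bounded_measurable f -> bounded_measurable g ->
  (forall x, f x <= g x) -> \int[P]_x f x <= \int[P]_x g x.
Proof.
move=> bf bg fg; apply: le_Rintegral => //; exact: bounded_measurable_integrable.
Qed.

Lemma Rintegral_sum_bounded (I : Type) (s : seq I) (F : I -> T -> R) :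
  (forall i, bounded_measurable (F i)) ->
  \int[P]_x (\sum_(i <- s) F i x) = \sum_(i <- s) \int[P]_x F i x.
Proof.
move=> bF; elim: s => [|i s IH].
  by under eq_Rintegral do rewrite big_nil; rewrite Rintegral_probability_cst big_nil.
under eq_Rintegral do rewrite big_cons.
rewrite big_cons -IH RintegralD_bounded//; exact: bounded_measurable_sum.
Qed.

Lemma Rintegral_indic_bounded (A : set T) : measurable A ->
  \int[P]_x (\1_A x : R) = fine (P A).
Proof. by move=> mA; rewrite /Rintegral integral_indic// setIT. Qed.

Lemma EFin_Rintegral_bounded f : bounded_measurable f ->
  (\int[P]_x (f x)%:E = (\int[P]_x f x)%:E)%E.
Proof. by move=> bf; rewrite EFin_Rintegral//; exact: bounded_measurable_integrable. Qed.

End bounded_measurable.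

Section cell_count.
Context d (T : measurableType d) (R : realType) (n : nat) (pi : probability T R).
Context (L : finType) (h : T -> L).
Hypothesis mh : forall Q, measurable (h @^-1` [set Q]).

Let Pn := tuple_product (n + n) (fun=> pi).
Let e (Q : L) (a : 'I_(n + n)) (t : (n + n).-tuple T) : R := (h (tnth t a) == Q)%:R.
Let p (Q : L) : R := fine (pi (h @^-1` [set Q])).

Let eE Q a : e Q a = \1_((@tnth _ T)^~ a @^-1` (h @^-1` [set Q])) :> (_ -> R).
Proof.
apply/funext => t; rewrite indicE /e; congr (nat_of_bool _)%:R.
by apply/eqP/idP => [E|/set_mem//]; exact/mem_set.
Qed.

Let mpre Q a : measurable ((@tnth (n + n) T)^~ a @^-1` (h @^-1` [set Q])).
Proof. by have := measurable_tnth a measurableT (mh Q); rewrite setTI. Qed.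

Let be Q a : bounded_measurable (e Q a).
Proof. by rewrite eE; exact: bounded_measurable_indic. Qed.

Let Ee Q a : \int[Pn]_t e Q a t = p Q.
Proof. by rewrite eE Rintegral_indic_bounded// tuple_product_tnth. Qed.

Let Eee Q a b : a != b -> \int[Pn]_t (e Q a t * e Q b t) = p Q ^+ 2.
Proof.
move=> ab; rewrite !eE.
transitivity (\int[Pn]_t (\1_(((@tnth _ T)^~ a @^-1` (h @^-1` [set Q])) `&`
    ((@tnth _ T)^~ b @^-1` (h @^-1` [set Q]))) t : R)).
  by apply: eq_Rintegral => t _; rewrite indicI.
rewrite Rintegral_indic_bounded; last exact: measurableI.
by rewrite tuple_product_tnth2// fineM ?fin_num_measure.
Qed.

Let sum_p : \sum_Q p Q = 1.
Proof.
transitivity (\int[pi]_t (\sum_Q \1_(h @^-1` [set Q]) t : R)).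
  rewrite Rintegral_sum_bounded; last by move=> Q; exact: bounded_measurable_indic.
  by apply: eq_bigr => Q _; rewrite Rintegral_indic_bounded.
rewrite -[RHS](Rintegral_probability_cst pi); apply: eq_Rintegral => t _.
rewrite (bigD1 (h t))//= indicE mem_set// big1 ?addr0// => Q hQ.
by rewrite indicE memNset//= => hQ'; rewrite hQ' eqxx in hQ.
Qed.

Let D Q (i : 'I_n) t := e Q (lshift n i) t - e Q (rshift n i) t.

Let bD Q i : bounded_measurable (D Q i).
Proof. exact: bounded_measurableB. Qed.

(** Both halves have the same law and distinct coordinates are independent, so off the diagonal the
    four products have equal means and cancel. On the diagonal the square is at most the sum of the
    two indicators. *)
Let ED2 Q i j : \int[Pn]_t (D Q i t * D Q j t) <= (i == j)%:R * (p Q *+ 2).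
Proof.
have [->|ij] := eqVneq i j.
  rewrite mul1r mulr2n -{1}(Ee Q (lshift n j)) -(Ee Q (rshift n j)).
  rewrite -RintegralD_bounded//; apply: le_Rintegral_bounded => [||t].
  - exact: bounded_measurableM.
  - exact: bounded_measurableD.
  rewrite /D /e; case: (_ == Q); case: (_ == Q);
    by rewrite ?(subrr, subr0, sub0r, mulrNN, mulr0, mulr1, addr0, add0r).
have ll : lshift n i != lshift n j by rewrite (inj_eq (@lshift_inj _ _)).
have rr : rshift n i != rshift n j by rewrite (inj_eq (@rshift_inj _ _)).
have lr : lshift n i != rshift n j by rewrite eq_lrshift.
have rl : rshift n i != lshift n j by rewrite eq_rlshift.
rewrite mul0r (_ : \int[Pn]_t _ = 0)//.
transitivity (\int[Pn]_t ((e Q (lshift n i) t * e Q (lshift n j) t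
   + e Q (rshift n i) t * e Q (rshift n j) t)
   - (e Q (lshift n i) t * e Q (rshift n j) t
   + e Q (rshift n i) t * e Q (lshift n j) t))).
  by apply: eq_Rintegral => t _; rewrite /D; ring.
have bM Q' a b : bounded_measurable (fun t => e Q' a t * e Q' b t).
  exact: bounded_measurableM.
rewrite RintegralB_bounded ?RintegralD_bounded ?Eee ?subrr//;
  exact: bounded_measurableD.
Qed.

Lemma cell_count : (0 < n)%N ->
  \int[Pn]_t (\sum_Q `| \sum_(i < n)
     ((h (tnth t (lshift n i)) == Q)%:R - (h (tnth t (rshift n i)) == Q)%:R) |)
  <= Num.sqrt (2 * n%:R * #|L|%:R).
Proof.
move=> n0; set r := Num.sqrt _.
have L0 : 0 < #|L|%:R :> R.
  by rewrite ltr0n; apply/card_gt0P; exists (h point).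
have n0' : 0 < n%:R :> R by rewrite ltr0n.
have rr : r ^+ 2 = 2 * n%:R * #|L|%:R by rewrite sqr_sqrtr// !mulr_ge0.
have r0 : 0 < r by rewrite sqrtr_gt0 !mulr_gt0.
(* The value balancing the two AM-GM terms: summed over the cells they are [n / s] and [s #|L| / 2],
   and each equals [r / 2]. *)
pose s := r / #|L|%:R.
have s0 : 0 < s by rewrite divr_gt0.
pose S Q t := \sum_(i < n) D Q i t.
have bS Q : bounded_measurable (S Q) by exact: bounded_measurable_sum.
have bSS Q : bounded_measurable (fun t => S Q t * S Q t) by exact: bounded_measurableM.
have ES Q : \int[Pn]_t (S Q t * S Q t) <= n%:R * (p Q *+ 2).
  rewrite (_ : (fun t => _) = (fun t => \sum_i \sum_j D Q i t * D Q j t)); last first.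
    by apply/funext => t; rewrite /S mulr_suml; apply: eq_bigr => i _; rewrite mulr_sumr.
  rewrite Rintegral_sum_bounded; last first.
    by move=> i; apply: bounded_measurable_sum => j; exact: bounded_measurableM.
  rewrite -[n in leRHS]card_ord -sum1_card natr_sum mulr_suml.
  apply: ler_sum => i _; rewrite Rintegral_sum_bounded; last first.
    by move=> j; exact: bounded_measurableM.
  apply: (@le_trans _ _ (\sum_j (i == j)%:R * (p Q *+ 2))).
    by apply: ler_sum => j _; exact: ED2.
  by rewrite (bigD1 i)//= eqxx big1 ?addr0// => j; rewrite eq_sym => /negbTE ->; rewrite mul0r.
(* AM-GM: [|S| <= S^2 / (2 s) + s / 2] *)
apply: (@le_trans _ _ (\sum_Q ((2 * s)^-1 * (n%:R * (p Q *+ 2)) + s / 2))).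
  rewrite Rintegral_sum_bounded; last by move=> Q; apply: bounded_measurable_norm; exact: bS.
  apply: ler_sum => Q _.
  apply: (@le_trans _ _ (\int[Pn]_t ((2 * s)^-1 * (S Q t * S Q t) + s / 2))).
    apply: le_Rintegral_bounded => [||t].
    - by apply: bounded_measurable_norm; exact: bS.
    - apply: bounded_measurableD; last exact: bounded_measurable_cst.
      by apply: bounded_measurableM => //; exact: bounded_measurable_cst.
    rewrite -/(S Q t) -[X in _ * X](@real_normK _ (S Q t)) ?num_real// -subr_ge0.
    rewrite (_ : _ - _ = (`|S Q t| - s) ^+ 2 / (2 * s)); last by field; exact: lt0r_neq0.
    by rewrite divr_ge0 ?sqr_ge0// mulr_ge0// ltW.
  rewrite RintegralD_bounded; last 2 first.
  - by apply: bounded_measurableM => //; exact: bounded_measurable_cst.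
  - exact: bounded_measurable_cst.
  rewrite Rintegral_probability_cst RintegralZ_bounded// lerD2r ler_wpM2l//.
  by rewrite invr_ge0 mulr_ge0// ltW.
rewrite big_split/= -!mulr_sumr sumrMnl sum_p sumr_const -[_ *+ #|_|]mulr_natr.
rewrite /s le_eqVlt; apply/orP; left; apply/eqP.
transitivity ((2 * n%:R * #|L|%:R + r ^+ 2) / (2 * r)).
  by field; rewrite !lt0r_neq0.
by rewrite -rr; field; exact: lt0r_neq0.
Qed.

End cell_count.

(** * Dyadic cells *)

Section dyadic.
Context (R : realType).

(* The dyadic interval of length [2^-k] containing [s], clamped to [0, 1). *)
Definition dyadic_index (k : nat) (s : R) : 'I_(2 ^ k).-1.+1 :=
  inord (minn (Num.truncn (2 ^+ k * s)) (2 ^ k).-1).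

Lemma dyadic_indexE k s :
  dyadic_index k s = minn (Num.truncn (2 ^+ k * s)) (2 ^ k).-1 :> nat.
Proof. by rewrite /dyadic_index inordK// ltnS geq_minr. Qed.

(** Truncation commutes with halving, and so does the clamp, since [(2 e).-1] halves to [e.-1]. The
    partition is therefore nested on the whole line, including points outside the unit interval. *)
Lemma dyadic_index_half k s : dyadic_index k s = (dyadic_index k.+1 s)./2 :> nat.
Proof.
rewrite !dyadic_indexE.
have -> : Num.truncn (2 ^+ k * s) = (Num.truncn (2 ^+ k.+1 * s))./2.
  have [s0|s0] := leP 0 s; last first.
    have tr0 j : Num.truncn (2 ^+ j * s) = 0%N.
      apply/truncn0Pn; rewrite -ltNge (lt_trans _ (@ltr01 R))//.
      by rewrite nmulr_llt0// exprn_gt0.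
    by rewrite !tr0.
  have t0 : 0 <= 2 ^+ k.+1 * s by rewrite mulr_ge0// exprn_ge0.
  have /andP[h1 h2] := truncn_itv t0.
  apply: truncn_def; move: h1 h2; set N := Num.truncn _.
  rewrite exprS -mulrA; set u := _ * s => h1 h2.
  have h3 := odd_double_half N.
  have h4 : N%:R = (odd N)%:R + 2 * (N./2)%:R :> R.
    by rewrite -[in LHS]h3 natrD -muln2 natrM mulrC.
  have h5 : N.+1%:R = N%:R + 1 :> R by rewrite -natr1.
  have h6 : (N./2).+1%:R = (N./2)%:R + 1 :> R by rewrite -natr1.
  have h7 : (0 : R) <= (odd N)%:R <= (1 : R) by case: (odd N); rewrite ?lexx ?ler01.
  by move: h7 => /andP[h7 h8]; apply/andP; split; lra.
set N := Num.truncn _; have := expn_gt0 2 k; rewrite expnS; set e := (2 ^ k)%N.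
clearbody N e => e0; have := odd_double_half N; have := odd_double_half (minn N (2 * e).-1).
case: (odd N); case: (odd _); lia.
Qed.

Lemma dyadic_index_close k s s' : 0 <= s < 1 -> 0 <= s' < 1 ->
  dyadic_index k s = dyadic_index k s' -> `|s - s'| <= 2 ^- k.
Proof.
move=> s01 s'01 /(congr1 val)/=; rewrite !dyadic_indexE.
have k0 : 0 < 2 ^+ k :> R by rewrite exprn_gt0.
have tr (u : R) : 0 <= u < 1 -> (Num.truncn (2 ^+ k * u) <= (2 ^ k).-1)%N.
  move=> /andP[u0 u1]; rewrite -ltnS prednK ?expn_gt0// truncn_lt_nat; last first.
    by rewrite mulr_ge0// ltW.
  by rewrite natrX gtr_pMr.
rewrite (minn_idPl (tr s s01)) (minn_idPl (tr s' s'01)) => ss'.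
have /andP[s0 _] := s01; have /andP[s'0 _] := s'01.
have := truncn_itv (mulr_ge0 (ltW k0) s0); have := truncn_itv (mulr_ge0 (ltW k0) s'0).
rewrite ss' -natr1 => /andP[h1 h2] /andP[h3 h4].
rewrite -(ler_pM2l k0) divff ?lt0r_neq0// -[X in X * _]gtr0_norm// -normrM mulrBr.
by rewrite ler_norml; apply/andP; split; lra.
Qed.

Lemma measurable_dyadic_index k (q : 'I_(2 ^ k).-1.+1) :
  measurable (dyadic_index k @^-1` [set q]).
Proof.
pose g s : R := (dyadic_index k s)%:R.
have mg : measurable_fun setT g.
  apply: nondecreasing_measurable => // s s' ss'.
  rewrite /g ler_nat !dyadic_indexE leq_min geq_minr andbT.
  apply: leq_trans (geq_minl _ _) _; apply: le_truncn.
  by rewrite ler_pM2l// exprn_gt0.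
have := mg measurableT [set (q : nat)%:R] (measurable_set1 _); rewrite setTI.
congr measurable; apply/seteqP; split=> s /=.
  by move=> /eqP; rewrite /g eqr_nat => /eqP /val_inj.
by rewrite /g => ->.
Qed.

End dyadic.

Section dyadic_cell.
Context (R : realType) (d : nat) (m : d.-tuple R).
Implicit Types z : d.-tuple R.

(** The points to be matched are sums of two points and fill a cube of side 4 with corner [m].
    Dividing by 5 instead of 4 keeps the coordinates strictly below 1. *)
Definition rescale z (i : 'I_d) : R := (tnth z i - tnth m i) / 5.

Definition dyadic_cell (k : nat) z : {ffun 'I_d -> 'I_(2 ^ k).-1.+1} :=
  [ffun i => dyadic_index k (rescale z i)].

Lemma dyadic_cell_nested k z z' :
  dyadic_cell k.+1 z = dyadic_cell k.+1 z' -> dyadic_cell k z = dyadic_cell k z'.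
Proof.
move=> /ffunP zz'; apply/ffunP => i; have := zz' i; rewrite !ffunE => e.
apply/val_inj; rewrite /= (dyadic_index_half k (rescale z i)).
by rewrite (dyadic_index_half k (rescale z' i)) e.
Qed.

Lemma measurable_dyadic_cell k (Q : {ffun 'I_d -> 'I_(2 ^ k).-1.+1}) :
  measurable (dyadic_cell k @^-1` [set Q]).
Proof.
have -> : dyadic_cell k @^-1` [set Q] = \bigcap_(i in [set: 'I_d])
    ((rescale ^~ i) @^-1` (dyadic_index k @^-1` [set Q i])).
  apply/seteqP; split=> z /=; first by move=> <- i _; rewrite ffunE.
  by move=> zQ; apply/ffunP => i; rewrite ffunE; exact: zQ.
apply: fin_bigcap_measurable => // i _.
have mr : measurable_fun setT (rescale ^~ i).
  apply: measurable_funM; last exact: measurable_cst.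
  by apply: measurable_funB; [exact: measurable_tnth|exact: measurable_cst].
by have := mr measurableT _ (measurable_dyadic_index (Q i)); rewrite setTI.
Qed.

Lemma card_dyadic_cell k :
  #|{ffun 'I_d -> 'I_(2 ^ k).-1.+1}| = ((2 ^ k) ^ d)%N.
Proof. by rewrite card_ffun !card_ord prednK// expn_gt0. Qed.

Definition cell_diam2 (k : nat) : R := 25 * d%:R * 4 ^- k.

(** Differences of squared diameters, so that the weights of the levels separating two points
    telescope to the squared diameter of the smallest cell containing both, up to [cell_diam2 K]. *)
Definition cell_weight (k : nat) : R := cell_diam2 k - cell_diam2 k.+1.

Lemma cell_weightE k : cell_weight k = 75 * d%:R * 4 ^- k.+1.
Proof. by rewrite /cell_weight /cell_diam2 exprS; field; rewrite expf_neq0. Qed.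

Lemma cell_weight_gt0 : (0 < d)%N -> forall k, 0 < cell_weight k.
Proof. by move=> d0 k; rewrite cell_weightE divr_gt0 ?exprn_gt0// mulr_gt0// ltr0n. Qed.

Definition in_cube z := forall i, 0 <= rescale z i < 1.

Lemma sqd_same_cell k z z' : in_cube z -> in_cube z' ->
  dyadic_cell k z = dyadic_cell k z' -> sqd z z' <= cell_diam2 k.
Proof.
move=> zc z'c /ffunP e; rewrite /sqd /cell_diam2.
apply: (@le_trans _ _ (\sum_(i < d) 25 * 4 ^- k)); last first.
  by rewrite sumr_const card_ord -[leLHS]mulr_natr mulrAC.
apply: ler_sum => i _; have := e i; rewrite !ffunE => ei.
have := dyadic_index_close (z'c i) (zc i) (esym ei).
rewrite (_ : rescale z' i - rescale z i = (tnth z' i - tnth z i) / 5); last first.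
  by rewrite /rescale; field.
rewrite normrM [X in _ * X]ger0_norm ?invr_ge0// ler_pdivrMr// => h.
rewrite -real_normK ?num_real// (_ : 25 * _ = (2 ^- k * 5) ^+ 2).
  apply: lerXn2r => //; rewrite nnegrE// mulr_ge0// invr_ge0.
have -> : 4 ^+ k = 2 ^+ k * 2 ^+ k :> R by rewrite -exprMn -natrM.
by rewrite invfM; ring.
Qed.

(** If the points still share a cell at the new level, its diameter suffices; if not, the new weight
    exactly compensates the decrease of [cell_diam2]. At level 0 there is a single cell. *)
Lemma sqd_le_tree_cost K z z' : in_cube z -> in_cube z' -> (0 < d)%N ->
  sqd z z' <= cell_diam2 K + tree_cost dyadic_cell K cell_weight z z'.
Proof.
move=> zc z'c d0; rewrite /tree_cost; elim: K => [|K IH].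
  rewrite big_ord0 addr0; apply: (sqd_same_cell zc z'c).
  apply/ffunP => i; rewrite !ffunE; apply/val_inj.
  by case: dyadic_index => -[]//; case: dyadic_index => -[].
rewrite big_ord_recr/=; have [e|ne] := eqVneq (dyadic_cell K.+1 z) (dyadic_cell K.+1 z').
  rewrite mulr0 addr0 (le_trans (sqd_same_cell zc z'c e))// lerDl sumr_ge0// => k _.
  by rewrite mulr_ge0// ltW// cell_weight_gt0.
rewrite mulr1 (le_trans IH)// le_eqVlt; apply/orP; left; apply/eqP.
by rewrite [cell_weight K]/cell_weight; ring.
Qed.

End dyadic_cell.

(** * Summing over the scales *)

Section rate.
Context (R : realType).

Lemma geometric_sum (x : R) K :
  (x - 1) * (\sum_(k < K) x ^+ k.+1) = x ^+ K.+1 - x.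
Proof.
elim: K => [|K IH]; first by rewrite big_ord0 mulr0 expr1 subrr.
by rewrite big_ord_recr/= mulrDr IH [x ^+ K.+2]exprS; ring.
Qed.

Lemma exp4V_le_powR (b n K : nat) : (0 < b)%N -> (0 < n)%N ->
  (n <= (2 ^ b) ^ K)%N -> 4 ^- K <= n%:R `^ (- (2 / b%:R)) :> R.
Proof.
move=> b0 n0 nK; rewrite powRN lef_pV2 ?posrE ?exprn_gt0 ?powR_gt0 ?ltr0n//.
have b0' : b%:R != 0 :> R by rewrite pnatr_eq0 -lt0n.
apply: (@le_trans _ _ (((2 ^ b) ^ K)%N%:R `^ (2 / b%:R))).
  by apply: ge0_ler_powR; rewrite ?nnegrE ?ler_nat ?divr_ge0.
rewrite -expnM natrX -powR_mulrn// -powRrM.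
rewrite (_ : _ * _ = (2 * K)%:R); last by rewrite !natrM; field.
by rewrite powR_mulrn// exprM -natrX.
Qed.

Lemma expn_up_log_le (p n : nat) : (1 < p)%N -> (0 < n)%N ->
  (p ^ up_log p n <= p * n)%N.
Proof.
move=> p1; case: n => [//|[|n]] _; first by rewrite up_log1 muln1 ltnW.
have K0 : (0 < up_log p n.+2)%N by rewrite up_log_gt0 p1.
by rewrite -(prednK K0) expnS leq_mul2l ltnW ?orbT// up_log_gtn.
Qed.

(** Isolates the ratio [sqrt (2^d) / 4], which is below, equal to or above 1 exactly when [d] is
    below, equal to or above 4. *)
Lemma tree_rate_bound (d n K : nat) : (0 < n)%N ->
  n%:R^-1 * \sum_(k < K) cell_weight R d k *
    Num.sqrt (2 * n%:R * ((2 ^ k.+1) ^ d)%:R) =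
  (Num.sqrt n%:R)^-1 * (Num.sqrt 2 * (75 * d%:R)) *
    \sum_(k < K) (Num.sqrt (2 ^+ d) / 4) ^+ k.+1.
Proof.
move=> n0; rewrite !mulr_sumr; apply: eq_bigr => k _.
rewrite cell_weightE -expnM mulnC expnM !natrX.
rewrite !sqrtrM ?mulr_ge0//; set r := Num.sqrt n%:R.
have -> : Num.sqrt ((2 ^+ d) ^+ k.+1) = Num.sqrt (2 ^+ d) ^+ k.+1 :> R.
  rewrite -[in LHS](@sqr_sqrtr R (2 ^+ d)) ?exprn_ge0// exprAC sqrtr_sqr.
  by rewrite ger0_norm// exprn_ge0// sqrtr_ge0.
have r0 : r != 0 by rewrite sqrtr_eq0 -ltNge ltr0n.
have -> : n%:R^-1 = r^-1 * r^-1 by rewrite -invfM -expr2 sqr_sqrtr.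
by rewrite expr_div_n; field; rewrite r0 expf_neq0.
Qed.

Lemma sqrtV_powR (n : nat) : (Num.sqrt n%:R)^-1 = n%:R `^ (- (1 / 2)) :> R.
Proof. by rewrite powRN div1r powR12_sqrt. Qed.

(** The depth makes the finest cells as small as the rate: [16^K >= n] for [d <= 4] and
    [2^(d K) >= n] for [d > 4]. The series is then bounded, of length [K = O(log n)] with unit
    terms, or dominated by its last term. The leading [n^(-1/2)] makes room for the random
    fluctuation. *)
Lemma tree_rate (d : nat) : (0 < d)%N -> exists2 C : R, 0 <= C &
  forall n, (0 < n)%N -> (d = 4%N -> (2 <= n)%N) -> exists K,
  (Num.sqrt n%:R)^-1 + cell_diam2 R d K + n%:R^-1 * \sum_(k < K)
    cell_weight R d k * Num.sqrt (2 * n%:R * ((2 ^ k.+1) ^ d)%:R)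
  <= C * rate R d n.
Proof.
move=> d0; pose x : R := Num.sqrt (2 ^+ d) / 4; pose c : R := Num.sqrt 2 * (75 * d%:R).
have c0 : 0 <= c by rewrite !mulr_ge0// sqrtr_ge0.
have x0 : 0 <= x by rewrite divr_ge0// sqrtr_ge0.
have xx : x ^+ 2 = 2 ^+ d / 16.
  by rewrite expr_div_n sqr_sqrtr ?exprn_ge0//; congr (_ / _); rewrite -natrX.
have d0' : 0 < d%:R :> R by rewrite ltr0n.
have [d4|d4|d4] := ltngtP d 4.
- have x1 : x < 1.
    rewrite -(@ltr_pXn2r _ 2) ?nnegrE// expr1n xx ltr_pdivrMr// mul1r.
    rewrite (_ : 16 = 2 ^+ 4); last by rewrite -natrX.
    by rewrite ltr_eXn2l// ltr1n.
  have x1' : 0 < 1 - x by lra.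
  exists (1 + 25 * d%:R + c / (1 - x)).
    by rewrite !addr_ge0// ?mulr_ge0// ?invr_ge0 ltW.
  move=> n n0 _; exists (up_log (2 ^ 4) n); set K := up_log _ _.
  rewrite tree_rate_bound// -/x -/c /rate.
  rewrite ltnNge (ltnW d4)/= (ltn_eqF d4) -sqrtV_powR.
  set u := (Num.sqrt _)^-1; have u0 : 0 <= u by rewrite invr_ge0 sqrtr_ge0.
  have hK : 4 ^- K <= u.
    rewrite /u sqrtV_powR (_ : 1 / 2 = 2 / 4%:R); last by field.
    by apply: exp4V_le_powR => //; exact: up_logP.
  have hS : \sum_(k < K) x ^+ k.+1 <= (1 - x)^-1.
    rewrite -(ler_pM2l x1') divff ?lt0r_neq0// -opprB mulNr geometric_sum.
    by have := exprn_ge0 K.+1 x0; lra.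
  rewrite mulrDl lerD//.
    by rewrite mulrDl mul1r lerD2l /cell_diam2 ler_wpM2l// mulr_ge0// ltW.
  by rewrite -mulrA mulrC ler_wpM2r// ler_wpM2l.
- have x1 : 1 < x.
    rewrite -(@ltr_pXn2r _ 2) ?nnegrE// expr1n xx ltr_pdivlMr// mul1r.
    rewrite (_ : 16 = 2 ^+ 4); last by rewrite -natrX.
    by rewrite ltr_eXn2l// ltr1n.
  have x1' : 0 < x - 1 by lra.
  pose q : R := Num.sqrt (2 ^+ d).
  have q0 : 0 <= q by rewrite sqrtr_ge0.
  exists (1 + 25 * d%:R + c * (x * q / (x - 1))).
    by rewrite !addr_ge0 ?mulr_ge0 ?invr_ge0 ?(ltW x1') ?(ltW d0').
  move=> n n0 _; exists (up_log (2 ^ d) n); set K := up_log _ _.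
  rewrite tree_rate_bound// -/x -/c /rate d4.
  set u := (Num.sqrt _)^-1; have u0 : 0 <= u by rewrite invr_ge0 sqrtr_ge0.
  have p1 : (1 < 2 ^ d)%N by rewrite -{1}(expn0 2) ltn_exp2l.
  set r := n%:R `^ _.
  have r0 : 0 <= r by exact: powR_ge0.
  have ur : u <= r.
    rewrite /u sqrtV_powR; apply: ler_powR; first by rewrite ler1n.
    rewrite lerN2 ler_pdivrMr// mulrAC ler_pdivlMr//.
    have : (4 : R) <= d%:R by rewrite (ler_nat _ 4) ltnW.
    lra.
  have hK : 4 ^- K <= r by apply: exp4V_le_powR => //; exact: up_logP.
  (* [up_log] overshoots by at most one factor: [2^(d K) <= 2^d n], and [q ^+ K] is the square root
     of the left side. *)
  have qK : u * q ^+ K <= q.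
    have n0' : 0 < Num.sqrt n%:R :> R by rewrite sqrtr_gt0 ltr0n.
    rewrite /u mulrC ler_pdivrMr// /q -sqrtrM ?exprn_ge0//.
    rewrite -[leLHS]ger0_norm ?exprn_ge0 ?sqrtr_ge0// -sqrtr_sqr.
    rewrite -exprM mulnC exprM sqr_sqrtr ?exprn_ge0//.
    apply: ler_wsqrtr; rewrite -!natrX -natrM ler_nat; exact: expn_up_log_le.
  have hS : u * \sum_(k < K) x ^+ k.+1 <= (x * q / (x - 1)) * r.
    rewrite mulrAC ler_pdivlMr// -mulrA [_ * (x - 1)]mulrC geometric_sum.
    apply: (@le_trans _ _ (u * x ^+ K.+1)); first by rewrite ler_wpM2l// lerBlDr lerDl.
    rewrite exprS mulrCA -[leRHS]mulrA ler_wpM2l//.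
    rewrite [x ^+ K]expr_div_n mulrA; apply: ler_pM => //.
      by rewrite mulr_ge0// exprn_ge0.
  rewrite mulrDl lerD//.
    rewrite mulrDl mul1r lerD// /cell_diam2 ler_wpM2l// mulr_ge0// ltW//.
  by rewrite [leLHS]mulrAC [leLHS]mulrC -[leRHS]mulrA ler_wpM2l.
- have x1 : x = 1.
    apply/eqP; rewrite -(@eqrXn2 _ 2)// expr1n xx d4 -natrX divff//.
  have l2 : 0 < ln 2 :> R by rewrite ln_gt0// ltr1n.
  have l16 : 0 < ln 16 :> R by rewrite ln_gt0// ltr1n.
  (* [101 = 1 + 25 * 4] collects the fluctuation and the finest cells. Since [n >= 2], a constant is
     at most that constant times [ln n / ln 2]; the same absorbs the 1 in
     [K <= 1 + ln n / ln 16]. *)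
  exists (101 / ln 2 + c * ((ln 2)^-1 + (ln 16)^-1)).
    by rewrite !addr_ge0 ?mulr_ge0 ?addr_ge0 ?invr_ge0 ?(ltW l2) ?(ltW l16).
  move=> n n0 /(_ d4) n2; exists (up_log (2 ^ 4) n); set K := up_log _ _.
  rewrite tree_rate_bound// -/x -/c /rate d4 /= -sqrtV_powR.
  set u := (Num.sqrt _)^-1; have u0 : 0 <= u by rewrite invr_ge0 sqrtr_ge0.
  have hK : 4 ^- K <= u.
    rewrite /u sqrtV_powR (_ : 1 / 2 = 2 / 4%:R); last by field.
    by apply: exp4V_le_powR => //; exact: up_logP.
  have ln2n : ln 2 <= ln n%:R :> R by rewrite ler_ln ?posrE ?ltr0n// ler_nat.
  have K16 : K%:R * ln 16 <= ln 16 + ln n%:R :> R.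
    rewrite -lnM ?posrE ?ltr0n// mulr_natl -lnXn//.
    rewrite ler_ln ?posrE ?exprn_gt0 ?mulr_gt0 ?ltr0n//.
    by rewrite -natrX -natrM ler_nat; exact: (@expn_up_log_le 16).
  rewrite x1 (eq_bigr (fun=> 1)); last by move=> k _; rewrite expr1n.
  rewrite sumr_const card_ord /cell_diam2.
  have e1 : 25 * 4%:R / 4 ^+ K <= 100 * u.
    by rewrite -natrM ler_wpM2l.
  have e2 : 101 * u <= 101 / ln 2 * (u * ln n%:R).
    rewrite [leRHS](_ : _ = 101 * (u * (ln n%:R / ln 2))); last first.
      by field; exact: lt0r_neq0.
    by rewrite ler_wpM2l// ler_peMr// ler_pdivlMr// mul1r.
  have e3 : K%:R <= ((ln 2)^-1 + (ln 16)^-1) * ln n%:R :> R.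
    rewrite -(ler_pM2r l16) (le_trans K16)//.
    rewrite [leRHS](_ : _ = ln 16 * (ln n%:R / ln 2) + ln n%:R); last first.
      by field; rewrite !lt0r_neq0.
    by rewrite lerD2r ler_peMr ?(ltW l16)// ler_pdivlMr// mul1r.
  have e4 := ler_wpM2l (mulr_ge0 u0 c0) e3.
  rewrite [leRHS]mulrDl; apply: (le_trans (lerD (lerD (lexx u) e1) e4)).
  by move: e2; lra.
Qed.

End rate.

(** * Concentration *)

Section subgaussian.
Context d (T : measurableType d) (R : realType) (P : probability T R).
Variables (F : T -> R) (E : R) (n : nat).
Hypothesis n0 : (0 < n)%N.
Hypothesis mF : measurable_fun setT F.
Hypothesis mgf : forall l,
  (\int[P]_x (expR (l * (F x - E)))%:E <= (expR (l ^+ 2 / (4 * n%:R)))%:E)%E.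

Let n0' : 0 < n%:R :> R. Proof. by rewrite ltr0n. Qed.

Let mexp l : measurable_fun setT (fun x => (expR (l * (F x - E)))%:E).
Proof.
apply/measurable_EFinP; apply: measurableT_comp => //.
by apply: measurable_funM => //; exact: measurable_funB.
Qed.

(** The sign of [l] selects the tail, so one statement covers both. *)
Let chernoff (t l : R) (A : set T) : measurable A ->
  (forall x, A x -> l * t <= l * (F x - E)) ->
  (P A <= (expR (l ^+ 2 / (4 * n%:R) - l * t))%:E)%E.
Proof.
move=> mA At; have -> : P A = (\int[P]_x (\1_A x)%:E)%E.
  by rewrite integral_indic// setIT.
apply: (@le_trans _ _ (\int[P]_x
   ((expR (- (l * t)))%:E * (expR (l * (F x - E)))%:E))%E).
  apply: ge0_le_integral => //.
  - by apply/measurable_EFinP; exact: measurable_indic.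
  - by apply: emeasurable_funM => //; exact: measurable_cst.
  - move=> x _; rewrite -EFinM -expRD lee_fin indicE.
    case: (boolP (x \in A)) => [/set_mem/At h|_]; last by rewrite expR_ge0.
    by rewrite (le_trans _ (expR_ge1Dx _))// -[leLHS]/(1 : R); lra.
rewrite ge0_integralZl//.
rewrite addrC expRD EFinM lee_wpmul2l//.
Qed.

Lemma subgaussian_tail t : 0 <= t ->
  (P [set x | (t <= `|F x - E|)%R] <= (2 * expR (- (n%:R * t ^+ 2)))%:E)%E.
Proof.
move=> t0.
have mFE : measurable_fun setT (fun x => F x - E) by exact: measurable_funB.
have mA1 : measurable [set x | t <= F x - E].
  have := @measurable_fun_ler _ _ R setT (cst t) _ (measurable_cst t) mFE measurableT [set true].
  by rewrite setTI; apply.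
have mA2 : measurable [set x | F x - E <= - t].
  have := @measurable_fun_ler _ _ R setT _ (cst (- t)) mFE (measurable_cst _) measurableT [set true].
  by rewrite setTI; apply.
have -> : [set x | t <= `|F x - E|] = [set x | t <= F x - E] `|` [set x | F x - E <= - t].
  apply/seteqP; split=> x /=; first by rewrite ler_normr => /orP[|]; [left|right; lra].
  by rewrite ler_normr => -[->//|h]; apply/orP; right; lra.
apply: (le_trans (measureU2 _ mA1 mA2)).
rewrite mulrDl mul1r EFinD; apply: leeD.
(* [l = 2 n t] minimises the exponent [l^2 / (4 n) - l t], with minimum [- n t^2]. *)
- rewrite (_ : - (n%:R * t ^+ 2) = (2 * n%:R * t) ^+ 2 / (4 * n%:R)
      - (2 * n%:R * t) * t); last first.
    by field; exact: lt0r_neq0.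
  by apply: chernoff => // x /= h; rewrite ler_wpM2l// !mulr_ge0.
- rewrite (_ : - (n%:R * t ^+ 2) = (- (2 * n%:R * t)) ^+ 2 / (4 * n%:R)
      - (- (2 * n%:R * t)) * (- t)); last first.
    by field; exact: lt0r_neq0.
  by apply: chernoff => // x /= h; rewrite ler_wnM2l// oppr_le0 !mulr_ge0.
Qed.

(** Instead of integrating the tail, use [l |y| <= expR (l y) + expR (- l y)] with [l = 2 sqrt n],
    for which each exponential moment is at most [expR 1]. *)
Lemma subgaussian_mean :
  (\int[P]_x (`|F x - E|)%:E <= (expR 1 / Num.sqrt n%:R)%:E)%E.
Proof.
have r0 : 0 < Num.sqrt n%:R :> R by rewrite sqrtr_gt0.
set r := Num.sqrt _ in r0 *; pose l := 2 * r.
have l0 : 0 < l by rewrite mulr_gt0.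
have rr : r ^+ 2 = n%:R by rewrite sqr_sqrtr// ltW.
have key l' : l' ^+ 2 = l ^+ 2 ->
    (\int[P]_x (expR (l' * (F x - E)))%:E <= (expR 1)%:E)%E.
  move=> ll; apply: (le_trans (mgf l')); rewrite ll lee_fin ler_expR.
  by rewrite /l exprMn rr le_eqVlt; apply/orP; left; apply/eqP; field; exact: lt0r_neq0.
apply: (@le_trans _ _ (\int[P]_x ((l^-1)%:E *
   ((expR (l * (F x - E)))%:E + (expR ((- l) * (F x - E)))%:E)))%E).
  apply: ge0_le_integral => //.
  - apply/measurable_EFinP; apply: measurableT_comp => //; exact: measurable_funB.
  - by apply: emeasurable_funM => //; apply: emeasurable_funD.
  - move=> x _; rewrite -EFinD -EFinM lee_fin mulrC ler_pdivlMr//.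
    set y := F x - E; have h1 := expR_ge1Dx (l * y); have h2 := expR_ge1Dx (- l * y).
    have h3 := expR_gt0 (l * y); have h4 := expR_gt0 (- l * y).
    by case: (leP 0 y) => [|/ltW] hy; [rewrite ger0_norm|rewrite ler0_norm] => //; lra.
rewrite ge0_integralZl//; last 3 first.
- by apply: emeasurable_funD.
- by move=> x _; rewrite adde_ge0// lee_fin expR_ge0.
- by rewrite lee_fin invr_ge0 ltW.
rewrite ge0_integralD//.
apply: (@le_trans _ _ ((l^-1)%:E * ((expR 1)%:E + (expR 1)%:E))%E).
  apply: lee_wpmul2l; first by rewrite lee_fin invr_ge0 ltW.
  by apply: leeD; apply: key; rewrite ?sqrrN.
rewrite -EFinD -EFinM lee_fin le_eqVlt; apply/orP; left; apply/eqP.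
by rewrite /l; field; exact: lt0r_neq0.
Qed.

End subgaussian.

(** * The cost of a pair of samples *)

Section empirical_cost.
Context (R : realType) (d n : nat).
Implicit Types x y : 'I_n.+1 -> d.-tuple R.

Definition empirical_cost x y : R := n.+1%:R^-1 *
  \sum_i sqd (x i) (y (optperm (fun i j => sqd (x i) (y j)) i)).

Lemma empirical_cost_le x y (s : {perm 'I_n.+1}) :
  empirical_cost x y <= n.+1%:R^-1 * \sum_i sqd (x i) (y (s i)).
Proof. by rewrite ler_wpM2l ?invr_ge0// (optpermP (fun i j => sqd (x i) (y j))). Qed.

Lemma empirical_cost_ge0 x y : 0 <= empirical_cost x y.
Proof. by rewrite mulr_ge0 ?invr_ge0// sumr_ge0// => i _; exact: sqd_ge0. Qed.

Lemma average_le1 (c : 'I_n.+1 -> R) : (forall i, c i <= 1) ->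
  n.+1%:R^-1 * \sum_i c i <= 1.
Proof.
move=> c1; rewrite mulrC ler_pdivrMr ?ltr0n// mul1r.
rewrite (le_trans (ler_sum _ (fun i _ => c1 i)))// sumr_const card_ord.
by [].
Qed.

Lemma measurable_empirical_cost dO (Omega : measurableType dO)
    (U V : 'I_n.+1 -> Omega -> d.-tuple R) :
  (forall i, measurable_fun setT (U i)) -> (forall i, measurable_fun setT (V i)) ->
  measurable_fun setT (fun w => empirical_cost (U^~ w) (V^~ w)).
Proof.
move=> mU mV; apply: measurable_funM; first exact: measurable_cst.
apply: (@measurable_select _ _ _ R _
  (fun w => optperm (fun i j => sqd (U i w) (V j w)))
  (fun s w => \sum_i sqd (U i w) (V (s i) w))).
  move=> s; apply: (measurable_optperm (c := fun i j w => sqd (U i w) (V j w))) => i j.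
  exact: measurable_sqd_comp.
by move=> s; apply: measurable_sum => i; exact: measurable_sqd_comp.
Qed.

(** Reuse for [x], [y] the matching optimal for [x'], [y']: only one pair changes, and its cost goes
    from at least 0 to at most 1. The index [f s] of that pair depends on the matching when it is a
    [y] that moves. *)
Lemma empirical_cost_change1 x y x' y' (f : {perm 'I_n.+1} -> 'I_n.+1) :
    (forall i j, sqd (x i) (y j) <= 1) ->
    (forall (s : {perm 'I_n.+1}) i, i != f s -> x i = x' i /\ y (s i) = y' (s i)) ->
  empirical_cost x y <= empirical_cost x' y' + n.+1%:R^-1.
Proof.
move=> xy1 e; set s := optperm (fun i j => sqd (x' i) (y' j)).
apply: (le_trans (empirical_cost_le x y s)).
rewrite /empirical_cost -/s -[X in _ <= _ + X]mulr1 -mulrDr.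
rewrite ler_wpM2l ?invr_ge0// (bigD1 (f s))//= [in leRHS](bigD1 (f s))//=.
rewrite [leLHS]addrC [leRHS]addrAC [leRHS]addrC lerD//.
  rewrite le_eqVlt; apply/orP; left; apply/eqP; apply: eq_bigr => i ifs.
  by have [-> ->] := e s i ifs.
by rewrite (le_trans (xy1 _ _))// lerDr sqd_ge0.
Qed.

End empirical_cost.

(** * Retraction onto the support *)

Section retraction.
Context (R : realType) (d : nat).

(** Two measurable sets contain the complement of [S], one null for [mu] and one for [nu]; their
    intersection still contains it and is null for both. Collapsing it to a point of [S], which
    exists because the diameter is not [-oo], puts all values of [f] in [S]. *)
Lemma support_retraction (S : set (d.-tuple R)) (mu nu : probability (d.-tuple R) R) :
    diameter S = 1%E -> supported_on mu S -> supported_on nu S ->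
  exists f : d.-tuple R -> d.-tuple R, exists N : set (d.-tuple R),
    [/\ measurable_fun setT f, measurable N, (forall u v, sqd (f u) (f v) <= 1),
        (forall u, ~ N u -> f u = u) & mu N = 0%E /\ nu N = 0%E].
Proof.
move=> S1 [B1 [mB1 muB1 SB1]] [B2 [mB2 nuB2 SB2]].
have [x0 Sx0] : S !=set0.
  apply/set0P/eqP => S0; move: S1; rewrite /diameter S0.
  rewrite (_ : [set _ | _ in _ & _ in _] = set0) ?ereal_sup0//.
  by apply/seteqP; split=> z //= [].
have mN : measurable (B1 `&` B2) by exact: measurableI.
pose f u := if u \in B1 `&` B2 then x0 else u.
have fS u : S (f u).
  rewrite /f; case: ifPn => //; rewrite notin_setE => nB.
  by apply: contrapT => nS; apply: nB; split; [exact: SB1|exact: SB2].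
exists f, (B1 `&` B2); split => //.
- apply: measurable_fun_ifT; [|exact: measurable_cst|exact: measurable_id].
  apply: (measurable_fun_bool true).
  rewrite setTI (_ : _ @^-1` _ = B1 `&` B2)//.
  by apply/seteqP; split=> u /=; [move/set_mem|move=> ?; exact/mem_set].
- move=> u v; rewrite -l2dist_sqr expr_le1// ?sqrtr_ge0//.
  rewrite -lee_fin -S1; apply: ereal_sup_ubound.
  by exists (f u) => //; exists (f v).
- by move=> u nB; rewrite /f memNset.
- split; first exact: (subset_measure0 mN mB1 (@subIsetl _ _ _) muB1).
  exact: (subset_measure0 mN mB2 (@subIsetr _ _ _) nuB2).
Qed.

Lemma law_retraction d1 (T : measurableType d1) (m : probability T R)
    (h : d.-tuple R -> d.-tuple R) (g : T -> d.-tuple R) (N : set (d.-tuple R)) :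
  measurable_fun setT h -> measurable_fun setT g -> measurable N ->
  (forall u, ~ N u -> h u = u) -> m (g @^-1` N) = 0%E ->
  forall A, measurable A -> m (g @^-1` (h @^-1` A)) = m (g @^-1` A).
Proof.
move=> mh mg mN hN mN0 A mA.
have mpre B : measurable B -> measurable (g @^-1` B).
  by move=> mB; have := mg measurableT B mB; rewrite setTI.
have mhA : measurable (h @^-1` A) by have := mh measurableT A mA; rewrite setTI.
rewrite -(probability_setI_full (mpre _ mhA) (mpre _ (measurableC mN))); last first.
  by rewrite preimage_setC setCK.
rewrite -(probability_setI_full (mpre _ mA) (mpre _ (measurableC mN))); last first.
  by rewrite preimage_setC setCK.
congr (m _); apply/seteqP; split=> t /= [At Nt]; split => //.
  by rewrite -(hN _ Nt).
by rewrite (hN _ Nt).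
Qed.

End retraction.

Section permuted_coupling.
Context (R : realType) (d n : nat) (mu nu : probability (d.-tuple R) R).
Context dO (Omega : measurableType dO) (P : probability Omega R).
Variables (x y : 'I_n.+1 -> Omega -> d.-tuple R) (s : Omega -> {perm 'I_n.+1}).
Hypotheses (mx : forall i, measurable_fun setT (x i))
  (my : forall i, measurable_fun setT (y i)).
Hypotheses (lawx : forall i A, measurable A -> P (x i @^-1` A) = mu A)
  (lawy : forall i A, measurable A -> P (y i @^-1` A) = nu A).
Hypothesis ms : forall t, measurable (s @^-1` [set t]).

Lemma measurable_permuted i : measurable_fun setT (fun w => y (s w i) w).
Proof. exact: (@measurable_select _ _ _ _ _ s (fun t w => y (t i) w)). Qed.

(* Averaging the couplings given by [s] over [Omega] yields a coupling of
   [mu] and [nu], whatever the dependence between the variables. *)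
Lemma W2sq_le_permuted : (W2sq mu nu <=
  \int[P]_w (n.+1%:R^-1 * \sum_i sqd (x i w) (y (s w i) w))%:E)%E.
Proof.
have avg (m : probability (d.-tuple R) R) A : measurable A ->
    ((n.+1%:R^-1)%:E * \sum_(i < n.+1) m A = m A)%E.
  move=> mA; rewrite -(fineK (fin_num_measure m A mA)) sumEFin sumr_const card_ord.
  by rewrite -EFinM -[X in _ * X]mulr_natl mulKf// pnatr_eq0.
apply: (@W2sq_le_average R d n _ _ P x (fun i w => y (s w i) w)) => //.
- exact: measurable_permuted.
- exact: probability_setT.
- move=> A mA; rewrite -[RHS]avg//; congr (_ * _)%E.
  by apply: eq_bigr => i _; exact: lawx.
- move=> A mA; rewrite -[RHS]avg//; congr (_ * _)%E.
  have mB i : measurable (y i @^-1` A) by have := my i measurableT mA; rewrite setTI.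
  rewrite -(eq_bigr _ (fun i _ => lawy i mA)) -(sum_measure_select _ ms mB).
  by [].
Qed.

End permuted_coupling.

Section sample_cost.
Context (R : realType) (d n : nat) (f : d.-tuple R -> d.-tuple R).
Hypotheses (mf : measurable_fun setT f) (f1 : forall u v, sqd (f u) (f v) <= 1).
Local Notation N := (n.+1 + n.+1)%N.

(** A retraction [f] makes this bounded by 1 everywhere; [f = idfun] gives the actual empirical
    cost, and the two agree almost surely. *)
Definition sample_cost (t : N.-tuple (d.-tuple R)) : R :=
  empirical_cost (fun i => f (tnth t (lshift n.+1 i)))
                 (fun j => f (tnth t (rshift n.+1 j))).

Lemma measurable_coordinate (a : 'I_N) :
  measurable_fun setT (fun t : N.-tuple (d.-tuple R) => f (tnth t a)).
Proof. exact: (measurableT_comp mf (measurable_tnth a)). Qed.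

Lemma measurable_sample_cost : measurable_fun setT sample_cost.
Proof.
by apply: measurable_empirical_cost => i; exact: measurable_coordinate.
Qed.

Lemma sample_cost01 t : 0 <= sample_cost t <= 1.
Proof. by rewrite empirical_cost_ge0/= average_le1. Qed.

Lemma bounded_measurable_sample_cost : bounded_measurable sample_cost.
Proof.
split; first exact: measurable_sample_cost.
by exists 1 => t; have /andP[? ?] := sample_cost01 t; rewrite ger0_norm.
Qed.

Lemma sample_cost_differences : bounded_differences sample_cost n.+1%:R^-1.
Proof.
have half a (t u : N.-tuple (d.-tuple R)) :
    (forall b, b != a -> tnth t b = tnth u b) ->
    sample_cost t <= sample_cost u + n.+1%:R^-1.
  (* The pair containing coordinate [a]: pairs are indexed by their [x], so a coordinate [j] of the
     second half belongs to pair [s^-1 j]. *)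
  move=> tu; pose g (s : {perm 'I_n.+1}) : 'I_n.+1 :=
    match fintype.split a with inl i => i | inr j => (s^-1)%g j end.
  apply: (@empirical_cost_change1 _ _ _ _ _ _ _ g) => // s i.
  rewrite /g; case: (fintype.splitP a) => [i0|j0] ae ig.
    have -> : tnth t (lshift n.+1 i) = tnth u (lshift n.+1 i).
      by apply: tu; apply: contra_neq ig => e; apply/val_inj; rewrite /= -ae -e.
    split=> //; congr f; apply: tu; apply/eqP => /(congr1 val)/=.
    rewrite ae; have := ltn_ord i0; lia.
  have -> : tnth t (rshift n.+1 (s i)) = tnth u (rshift n.+1 (s i)).
    apply: tu; apply: contra_neq ig => E.
    rewrite -[LHS](permK s); congr ((s^-1)%g _); apply/val_inj.
    by apply/(@addnI n.+1); rewrite -ae -E.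
  split=> //; congr f; apply: tu; apply/eqP => /(congr1 val)/=.
  rewrite ae; have := ltn_ord i; lia.
move=> a t u tu; rewrite ler_norml.
have := half a t u tu; have := half a u t (fun b ba => esym (tu b ba)).
set c := n.+1%:R^-1 => h1 h2; apply/andP; split.
  by rewrite lerNl opprB lerBlDl.
by rewrite lerBlDl.
Qed.

(** With sample size [n.+1], twice that many coordinates of oscillation [n.+1%:R^-1] turn
    [m c^2 / 8] into [1 / (4 n.+1)]. *)
Lemma sample_cost_mgf (mus : nat -> probability (d.-tuple R) R) (l : R) :
  (\int[tuple_product N mus]_t
     (expR (l * (sample_cost t - \int[tuple_product N mus]_u sample_cost u)))%:E
   <= (expR (l ^+ 2 / (4 * n.+1%:R)))%:E)%E.
Proof.
have c0 : 0 < n.+1%:R^-1 :> R by rewrite invr_gt0.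
have := tuple_product_mgf mus l c0 measurable_sample_cost sample_cost01
  sample_cost_differences.
move=> /le_trans; apply; rewrite lee_fin ler_expR le_eqVlt; apply/orP; left; apply/eqP.
have : n.+1%:R != 0 :> R by rewrite pnatr_eq0.
by rewrite natrD; set c := n.+1%:R => hc; field.
Qed.

End sample_cost.

(** * The upper bound on the mean *)

Section sqd_sum.
Context (R : realType) (d : nat).
Implicit Types x y a b p : d.-tuple R.

Definition tuple_add x y : d.-tuple R := [tuple tnth x k + tnth y k | k < d].

(* The identity [|x - y|^2 + |b - a|^2 - |x - a|^2 - |b - y|^2 = 2 (x - b).(a - y)]
   combined with [4 u.v <= |u + v|^2]. *)
Lemma sqd_cross x y a b :
  sqd x y <= sqd x a + sqd b y - sqd b a
             + 2^-1 * sqd (tuple_add x a) (tuple_add b y).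
Proof.
rewrite /sqd -big_split/= -sumrB mulr_sumr -big_split/=; apply: ler_sum => i _.
rewrite !tnth_mktuple; set x' := tnth x i; set y' := tnth y i.
set a' := tnth a i; set b' := tnth b i.
rewrite -subr_ge0 (_ : _ - _ = 2^-1 * (x' - b' - (a' - y')) ^+ 2); last by field.
by rewrite mulr_ge0// sqr_ge0.
Qed.

Lemma sqd_le1_coord x y i : sqd x y <= 1 -> `|tnth y i - tnth x i| <= 1.
Proof.
move=> xy1; rewrite -(@expr_le1 _ 2)// real_normK ?num_real//.
apply: le_trans xy1; rewrite /sqd (bigD1 i)//= lerDl sumr_ge0// => j _.
exact: sqr_ge0.
Qed.

(** Two points within distance 1 of [p] have a sum whose coordinates lie within 2 of those of
    [2 p]. *)
Definition cube_corner p : d.-tuple R := [tuple 2 * tnth p k - 2 | k < d].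

Lemma in_cube_add p x y : sqd p x <= 1 -> sqd p y <= 1 ->
  in_cube (cube_corner p) (tuple_add x y).
Proof.
move=> px py i; have := sqd_le1_coord i px; have := sqd_le1_coord i py.
rewrite /rescale !tnth_mktuple !ler_norml => /andP[h1 h2] /andP[h3 h4].
by apply/andP; split; lra.
Qed.

Lemma measurable_tuple_add dO (Omega : measurableType dO) (U V : Omega -> d.-tuple R) :
  measurable_fun setT U -> measurable_fun setT V ->
  measurable_fun setT (fun w => tuple_add (U w) (V w)).
Proof.
move=> mU mV; apply/measurable_fun_tnthP => i.
rewrite (_ : _ \o _ = (fun w => tnth (U w) i + tnth (V w) i)); last first.
  by apply/funext => w /=; rewrite tnth_mktuple.
by apply: measurable_funD; [exact: measurableT_comp (measurable_tnth i) mU|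
  exact: measurableT_comp (measurable_tnth i) mV].
Qed.

End sqd_sum.

Section lifted_sample.
Context (R : realType) (d n : nat) (d0 : (0 < d)%N).
Variables (f : d.-tuple R -> d.-tuple R).
Hypotheses (mf : measurable_fun setT f) (f1 : forall u v, sqd (f u) (f v) <= 1).
Variables (mu nu : probability (d.-tuple R) R).
Hypotheses (fmu : forall A, measurable A -> mu (f @^-1` A) = mu A)
  (fnu : forall A, measurable A -> nu (f @^-1` A) = nu A).
Variable pi : probability (d.-tuple R * d.-tuple R)%type R.
Hypothesis pi_coupling : couplings mu nu pi.
Local Notation N := (n.+1 + n.+1)%N.
Local Notation T0 := (d.-tuple R).
Local Notation T2 := (d.-tuple R * d.-tuple R)%type.

Definition sample_marginal (k : nat) : probability (d.-tuple R) R :=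
  if (k < n.+1)%N then mu else nu.

Let Q := tuple_product N (fun=> pi).
(** The two samples inside [2 n.+1] independent draws from [pi]: first components in the first half,
    second components in the second. The other components are the auxiliary points [a] and [b]. *)
Let Z (k : 'I_N) (w : N.-tuple T2) : T0 :=
  if (k < n.+1)%N then (tnth w k).1 else (tnth w k).2.
Let x i (w : N.-tuple T2) := f (tnth w (lshift n.+1 i)).1.
Let a i (w : N.-tuple T2) := f (tnth w (lshift n.+1 i)).2.
Let b i (w : N.-tuple T2) := f (tnth w (rshift n.+1 i)).1.
Let y i (w : N.-tuple T2) := f (tnth w (rshift n.+1 i)).2.

Let mtnth (k : 'I_N) : measurable_fun setT (fun w : N.-tuple T2 => tnth w k).
Proof. exact: measurable_tnth. Qed.

Let mfst (k : 'I_N) : measurable_fun setT (fun w : N.-tuple T2 => (tnth w k).1).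
Proof. exact: (measurableT_comp measurable_fst (mtnth k)). Qed.

Let msnd (k : 'I_N) : measurable_fun setT (fun w : N.-tuple T2 => (tnth w k).2).
Proof. exact: (measurableT_comp measurable_snd (mtnth k)). Qed.

Let mx i : measurable_fun setT (x i).
Proof. exact: (measurableT_comp mf (mfst _)). Qed.
Let ma i : measurable_fun setT (a i).
Proof. exact: (measurableT_comp mf (msnd _)). Qed.
Let mb i : measurable_fun setT (b i).
Proof. exact: (measurableT_comp mf (mfst _)). Qed.
Let my i : measurable_fun setT (y i).
Proof. exact: (measurableT_comp mf (msnd _)). Qed.

Let pre dU dV (U : measurableType dU) (V : measurableType dV) (g : U -> V) A :
  measurable_fun setT g -> measurable A -> measurable (g @^-1` A).
Proof. by move=> mg mA; have := mg measurableT A mA; rewrite setTI. Qed.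

(** [Z] reads one component of each draw, so its law is the product of the corresponding marginals
    of [pi], which is the law of the two samples. *)
Lemma lifted_sample_cost :
  \int[tuple_product N sample_marginal]_t sample_cost f t =
  \int[Q]_w empirical_cost (x^~ w) (y^~ w).
Proof.
rewrite /Rintegral; congr fine.
rewrite -(@sample_integral _ T0 R _ _ Q N Z sample_marginal _ _
   (EFin \o sample_cost f)).
- have Zl i w : f (tnth [tuple Z k w | k < N] (lshift n.+1 i)) = x i w.
    by rewrite tnth_mktuple /Z /x /= ltn_ord.
  have Zr i w : f (tnth [tuple Z k w | k < N] (rshift n.+1 i)) = y i w.
    by rewrite tnth_mktuple /Z /y /= ltnNge leq_addr.
  apply: eq_integral => w _; rewrite /= /sample_cost.
  by rewrite (funext (fun i => Zl i w)) (funext (fun i => Zr i w)).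
- move=> k; rewrite /Z; case: (k < n.+1)%N; [exact: mfst|exact: msnd].
- move=> A mA.
  pose B (k : 'I_N) : set T2 := if (k < n.+1)%N then fst @^-1` A k else snd @^-1` A k.
  have mB k : measurable (B k).
    by rewrite /B; case: ifP => _; apply: pre.
  rewrite (_ : \bigcap_(i in _) _ = tuple_rect B).
    rewrite tuple_product_rect//; apply: eq_bigr => k _.
    rewrite /B /sample_marginal; case: ifP => _.
      exact: (pi_coupling.1 _ (mA k)).
    exact: (pi_coupling.2 _ (mA k)).
  apply/seteqP; split=> w /= h.
    by move=> k; have := h k Logic.I; rewrite /Z /B; case: ifP.
  by move=> k _; have := h k; rewrite /Z /B; case: ifP.
- by apply/measurable_EFinP; exact: measurable_sample_cost.
- by move=> t; rewrite lee_fin; have /andP[] := sample_cost01 f1 t.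
Qed.

Let coord_integral (g : T2 -> R) k : bounded_measurable g ->
  \int[Q]_w g (tnth w k) = \int[pi]_z g z.
Proof.
move=> bg; pose tk : {mfun N.-tuple T2 >-> T2} :=
  HB.pack (fun w : N.-tuple T2 => tnth w k) (isMeasurableFun.Build _ _ _ _ _ (mtnth k)).
rewrite /Rintegral; congr fine.
have -> : (\int[pi]_z (g z)%:E = \int[distribution Q tk]_z (g z)%:E)%E.
  apply: eq_measure_integral => A mA _.
  by rewrite /distribution /pushforward; exact/esym/tuple_product_tnth.
rewrite integral_distribution//; first by apply/measurable_EFinP; case: bg.
apply: (@bounded_measurable_integrable _ _ _ Q (fun w => g (tnth w k))).
split; first exact: measurableT_comp bg.1 (mtnth k).
by have [_ [M gM]] := bg; exists M => w.
Qed.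

Let sbm dO (Omega : measurableType dO) (U V : Omega -> T0) :
  measurable_fun setT U -> measurable_fun setT V ->
  bounded_measurable (fun w => sqd (f (U w)) (f (V w))).
Proof.
move=> mU mV; split.
  by apply: measurable_sqd_comp; apply: measurableT_comp mf _.
by exists 1 => w; rewrite ger0_norm ?sqd_ge0.
Qed.

(** Any value of [f] can serve as centre, since all values of [f] are within distance 1 of each
    other. *)
Let p0 : T0 := f point.
(** Applied to draws of either half, this gives [x + a] and [b + y] as samples of one and the same
    law, which is why their cell counts nearly agree although [mu] and [nu] differ. *)
Let zmap (z : T2) : T0 := tuple_add (f z.1) (f z.2).
Let cell k z := dyadic_cell (cube_corner p0) k z.
Let tc K (w : N.-tuple T2) (i j : 'I_n.+1) : R :=
  tree_cost cell K (cell_weight R d)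
    (zmap (tnth w (lshift n.+1 i))) (zmap (tnth w (rshift n.+1 j))).
(** Optimal for the tree cost of the sums; for the cost between [x] and [y] and for the one between
    [b] and [a] it is merely some matching. *)
Let s K (w : N.-tuple T2) := optperm (tc K w).

Let mzmap : measurable_fun setT zmap.
Proof.
by apply: measurable_tuple_add; apply: measurableT_comp mf _.
Qed.

Let mcell k q : measurable ((fun z => cell k (zmap z)) @^-1` [set q]).
Proof. exact: (pre mzmap (measurable_dyadic_cell (cube_corner p0) q)). Qed.

Let ms K t : measurable (s K @^-1` [set t]).
Proof.
apply: (measurable_optperm (c := fun i j w => tc K w i j)) => i j.
apply: measurable_sum => k; apply: measurable_funM; first exact: measurable_cst.
pose g w := (cell k.+1 (zmap (tnth w (lshift n.+1 i))),
             cell k.+1 (zmap (tnth w (rshift n.+1 j)))).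
apply: (@measurable_select _ _ _ R _ g (fun p w => (p.1 != p.2)%:R)) => [[q r]|p].
  rewrite (_ : _ @^-1` _ =
     ((fun w => tnth w (lshift n.+1 i)) @^-1` ((fun z => cell k.+1 (zmap z)) @^-1` [set q])) `&`
     ((fun w => tnth w (rshift n.+1 j)) @^-1` ((fun z => cell k.+1 (zmap z)) @^-1` [set r]))).
    by apply: measurableI; [exact: (pre (mtnth _) (mcell q))|exact: (pre (mtnth _) (mcell r))].
  by apply/seteqP; split=> w /= [<- <-].
exact: measurable_cst.
Qed.

Let incube z : in_cube (cube_corner p0) (zmap z).
Proof. by apply: in_cube_add; exact: f1. Qed.

Definition tree_bound K : R := cell_diam2 R d K + n.+1%:R^-1 * \sum_(k < K)
  cell_weight R d k * Num.sqrt (2 * n.+1%:R * ((2 ^ k.+1) ^ d)%:R).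

Let Nerr k (w : N.-tuple T2) : R :=
  \sum_(q : {ffun 'I_d -> 'I_(2 ^ k.+1).-1.+1}) `| \sum_(i < n.+1)
     ((cell k.+1 (zmap (tnth w (lshift n.+1 i))) == q)%:R
      - (cell k.+1 (zmap (tnth w (rshift n.+1 i))) == q)%:R) |.

Let pointwise K w : empirical_cost (x^~ w) (y^~ w) +
   n.+1%:R^-1 * (\sum_i sqd (b (s K w i) w) (a i w)) <=
   n.+1%:R^-1 * (\sum_i sqd (x i w) (a i w)) +
   n.+1%:R^-1 * (\sum_i sqd (b i w) (y i w)) +
   2^-1 * (cell_diam2 R d K + n.+1%:R^-1 * \sum_(k < K) cell_weight R d k * Nerr k w).
Proof.
rewrite -lerBrDr; apply: (le_trans (empirical_cost_le _ _ (s K w))).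
have n0 : 0 <= n.+1%:R^-1 :> R by rewrite invr_ge0.
have h1 : \sum_i sqd (x i w) (y (s K w i) w) <= \sum_i sqd (x i w) (a i w)
   + \sum_i sqd (b i w) (y i w) - \sum_i sqd (b (s K w i) w) (a i w)
   + 2^-1 * \sum_i sqd (zmap (tnth w (lshift n.+1 i)))
       (zmap (tnth w (rshift n.+1 (s K w i)))).
  rewrite [X in _ + X - _](reindex_inj (@perm_inj _ (s K w)))/=.
  rewrite -big_split/= -sumrB mulr_sumr -big_split/=; apply: ler_sum => i _.
  exact: sqd_cross.
have h2 : \sum_i sqd (zmap (tnth w (lshift n.+1 i)))
       (zmap (tnth w (rshift n.+1 (s K w i)))) <=
   n.+1%:R * cell_diam2 R d K + \sum_i tc K w i (s K w i).
  apply: (@le_trans _ _ (\sum_(i < n.+1) (cell_diam2 R d K + tc K w i (s K w i)))).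
    by apply: ler_sum => i _; exact: sqd_le_tree_cost.
  by rewrite big_split/= sumr_const card_ord lerD2r [leRHS]mulr_natl.
have h3 : \sum_i tc K w i (s K w i) <= \sum_(k < K) cell_weight R d k * Nerr k w.
  exact: (@tree_matching R T0 _ cell K (cell_weight R d)
    (@dyadic_cell_nested R d (cube_corner p0)) (cell_weight_gt0 R d0) n.+1
    (fun i => zmap (tnth w (lshift n.+1 i)))
    (fun i => zmap (tnth w (rshift n.+1 i))) (s K w) (optpermP (tc K w))).
apply: (le_trans (ler_wpM2l n0 h1)).
have h4 := le_trans h2 (lerD (lexx _) h3).
have h5 := ler_wpM2l n0 h4.
rewrite [leLHS]mulrDr mulrBr mulrDr [leRHS]addrAC lerD2l mulrCA ler_wpM2l//.
by apply: (le_trans h5); rewrite mulrDr lerD2r mulrA mulVf ?mul1r.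
Qed.

(** [V] is the mean cost of the pairs [b_s(i)], [a_i]. It is hidden behind an existential because
    later only its lower bound by [W2sq mu nu] matters. *)
Lemma lifted_upper_bound K : exists2 V : R, (W2sq mu nu <= V%:E)%E &
  \int[tuple_product N sample_marginal]_t sample_cost f t + V <=
  2 * \int[pi]_z sqd (f z.1) (f z.2) + 2^-1 * tree_bound K.
Proof.
have n1 : 0 <= n.+1%:R^-1 :> R by rewrite invr_ge0.
pose v w := n.+1%:R^-1 * (\sum_i sqd (b (s K w i) w) (a i w)).
have bv : bounded_measurable v.
  split.
    apply: (@measurable_select _ _ _ R _ (s K)
      (fun t w => n.+1%:R^-1 * (\sum_i sqd (b (t i) w) (a i w))) (@ms K)) => t.
    apply: measurable_funM; first exact: measurable_cst.
    by apply: measurable_sum => i; exact: measurable_sqd_comp.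
  exists 1 => w; rewrite ger0_norm; first by apply: average_le1 => i; exact: f1.
  by rewrite /v mulr_ge0// sumr_ge0// => i _; exact: sqd_ge0.
exists (\int[Q]_w v w).
  rewrite -EFin_Rintegral_bounded//.
  have lawQ (g : T2 -> T0) (m : probability T0 R) k A :
      measurable_fun setT g -> (forall B, measurable B -> pi (g @^-1` B) = m B) ->
      (forall B, measurable B -> m (f @^-1` B) = m B) -> measurable A ->
      Q ((fun w => f (g (tnth w k))) @^-1` A) = m A.
    move=> mg gm fm mA; rewrite -fm// -gm; last exact: pre.
    by rewrite -(@tuple_product_tnth _ _ _ N (fun=> pi) k)//; do 2?apply: pre.
  (* [W2sq_le_permuted] permutes the second family, whereas [s] acts on the first one, [b]; hence
     the inverse permutation. *)
  have ms' t : measurable ((fun w => (s K w)^-1%g) @^-1` [set t]).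
    rewrite (_ : _ @^-1` _ = s K @^-1` [set t^-1%g]); first exact: ms.
    by apply/seteqP; split=> w /= => [<-|->]; rewrite invgK.
  have := @W2sq_le_permuted R d n mu nu _ _ Q b a (fun w => (s K w)^-1%g) mb ma _ _ ms'.
  move=> H; apply: le_trans (H _ _) _.
  - move=> i A mA; apply: (lawQ fst) => //; exact: pi_coupling.1.
  - move=> i A mA; apply: (lawQ snd) => //; exact: pi_coupling.2.
  rewrite le_eqVlt; apply/orP; left; apply/eqP; apply: eq_integral => w _.
  congr (_ * _)%:E; rewrite [LHS](reindex_inj (@perm_inj _ (s K w)))/=.
  by apply: eq_bigr => i _; rewrite permK.
have be : bounded_measurable (fun w => empirical_cost (x^~ w) (y^~ w)).
  split; first exact: measurable_empirical_cost.
  exists 1 => w; rewrite ger0_norm ?empirical_cost_ge0//.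
  by apply: average_le1 => i; exact: f1.
have bavg (g h : 'I_n.+1 -> N.-tuple T2 -> T0) :
    (forall i, bounded_measurable (fun w => sqd (g i w) (h i w))) ->
    bounded_measurable (fun w => n.+1%:R^-1 * (\sum_i sqd (g i w) (h i w))).
  move=> gh; apply: bounded_measurableM; first exact: bounded_measurable_cst.
  exact: bounded_measurable_sum.
have bxa i : bounded_measurable (fun w => sqd (x i w) (a i w)) by exact: sbm.
have bby i : bounded_measurable (fun w => sqd (b i w) (y i w)) by exact: sbm.
have bpi : bounded_measurable (fun z : T2 => sqd (f z.1) (f z.2)) by exact: sbm.
have beq k q l : bounded_measurable (fun w : N.-tuple T2 =>
    (cell k.+1 (zmap (tnth w l)) == q)%:R : R).
  rewrite (_ : (fun w => _) = \1_((fun w : N.-tuple T2 => tnth w l) @^-1`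
      ((fun z => cell k.+1 (zmap z)) @^-1` [set q]))).
    by apply: bounded_measurable_indic; apply: (pre (mtnth l)); exact: mcell.
  apply/funext => w; rewrite indicE; congr (nat_of_bool _)%:R.
  by apply/eqP/idP => [e|/set_mem//]; exact/mem_set.
have bN k : bounded_measurable (Nerr k).
  apply: bounded_measurable_sum => q; apply: bounded_measurable_norm.
  apply: bounded_measurable_sum => i.
  by apply: bounded_measurableB; exact: beq.
have bsum : bounded_measurable (fun w => \sum_(k < K) cell_weight R d k * Nerr k w).
  apply: bounded_measurable_sum => k; apply: bounded_measurableM => //.
  exact: bounded_measurable_cst.
have bsum1 : bounded_measurable (fun w =>
    n.+1%:R^-1 * \sum_(k < K) cell_weight R d k * Nerr k w).
  by apply: bounded_measurableM => //; exact: bounded_measurable_cst.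
have bsum2 : bounded_measurable (fun w => cell_diam2 R d K +
    n.+1%:R^-1 * \sum_(k < K) cell_weight R d k * Nerr k w).
  by apply: bounded_measurableD => //; exact: bounded_measurable_cst.
rewrite lifted_sample_cost -RintegralD_bounded//.
apply: (le_trans (le_Rintegral_bounded Q _ _ (pointwise K))).
- exact: bounded_measurableD.
- apply: bounded_measurableD; first by apply: bounded_measurableD; exact: bavg.
  by apply: bounded_measurableM => //; exact: bounded_measurable_cst.
rewrite RintegralD_bounded; last 2 first.
- by apply: bounded_measurableD; exact: bavg.
- by apply: bounded_measurableM => //; exact: bounded_measurable_cst.
rewrite RintegralD_bounded; [|exact: bavg|exact: bavg].
have avgE (g h : 'I_n.+1 -> N.-tuple T2 -> T0) c :
    (forall i, bounded_measurable (fun w => sqd (g i w) (h i w))) ->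
    (forall i, \int[Q]_w sqd (g i w) (h i w) = c) ->
    \int[Q]_w (n.+1%:R^-1 * (\sum_i sqd (g i w) (h i w))) = c.
  move=> gh ghc; rewrite RintegralZ_bounded; last exact: bounded_measurable_sum.
  rewrite Rintegral_sum_bounded// (eq_bigr (fun=> c))// sumr_const card_ord.
  by rewrite -[X in _ * X]mulr_natl mulKf// pnatr_eq0.
rewrite (avgE x a (\int[pi]_z sqd (f z.1) (f z.2)))//; last first.
  by move=> i; exact: (coord_integral (lshift n.+1 i) bpi).
rewrite (avgE b y (\int[pi]_z sqd (f z.1) (f z.2)))//; last first.
  by move=> i; exact: (coord_integral (rshift n.+1 i) bpi).
rewrite mulr_natl mulr2n lerD2l RintegralZ_bounded// ler_wpM2l//.
rewrite RintegralD_bounded//; last exact: bounded_measurable_cst.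
rewrite Rintegral_probability_cst RintegralZ_bounded// lerD2l ler_wpM2l//.
rewrite Rintegral_sum_bounded; last first.
  by move=> k; apply: bounded_measurableM => //; exact: bounded_measurable_cst.
apply: ler_sum => k _; rewrite RintegralZ_bounded//.
rewrite ler_wpM2l//; first by rewrite ltW// cell_weight_gt0.
rewrite -card_dyadic_cell.
by apply: (cell_count pi (h := fun z => cell k.+1 (zmap z))) => // q; exact: mcell.
Qed.

End lifted_sample.

(** * The two samples as one independent tuple *)

Section two_samples.
Context (R : realType) (d n : nat).
Context (mu nu : probability (d.-tuple R) R).
Context dO (Omega : measurableType dO) (P : probability Omega R).
Variables X Y : 'I_n.+1 -> {RV P >-> d.-tuple R}.
Hypotheses (lawX : forall i, has_law P (X i) mu) (lawY : forall i, has_law P (Y i) nu).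
Hypothesis indXY : mutually_independent P (joint_family X Y).
Local Notation N := (n.+1 + n.+1)%N.

Definition pooled_sample (k : 'I_N) (w : Omega) : d.-tuple R :=
  joint_family X Y (fintype.split k) w.

Lemma measurable_pooled_sample k : measurable_fun setT (pooled_sample k).
Proof. by rewrite /pooled_sample; case: (fintype.split k) => i /=; exact: measurable_funP. Qed.

Lemma pooled_sample_independent (A : 'I_N -> set (d.-tuple R)) :
  (forall k, measurable (A k)) ->
  P (\bigcap_(k in [set: 'I_N]) (pooled_sample k @^-1` A k)) =
  (\prod_(k < N) sample_marginal n mu nu k (A k))%E.
Proof.
move=> mA; have := indXY [set: 'I_n.+1 + 'I_n.+1]%SET (fun k => mA (unsplit k)).
have -> : \bigcap_(i in [set` [set: 'I_n.+1 + 'I_n.+1]%SET])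
    (joint_family X Y i @^-1` A (unsplit i)) =
    \bigcap_(k in [set: 'I_N]) (pooled_sample k @^-1` A k).
  apply/seteqP; split=> w /= h.
    by move=> k _; have := h (fintype.split k); rewrite /= inE splitK; apply.
  by move=> i _; have := h (unsplit i) Logic.I; rewrite /= /pooled_sample unsplitK.
move=> ->; rewrite big_split_ord/=.
rewrite (eq_bigl xpredT); last by move=> i; rewrite inE.
rewrite big_sumType/=; congr (_ * _)%E; apply: eq_bigr => i _.
  by rewrite /sample_marginal /= ltn_ord; exact: lawX.
by rewrite /sample_marginal /= ltnNge leq_addr; exact: lawY.
Qed.

End two_samples.

(** * Comparison of the mean with the true cost *)

Section main.
Context (R : realType) (d n : nat) (d0 : (0 < d)%N).
Context (mu nu : probability (d.-tuple R) R) (f : d.-tuple R -> d.-tuple R).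
Context (M : set (d.-tuple R)).
Hypotheses (mf : measurable_fun setT f) (f1 : forall u v, sqd (f u) (f v) <= 1).
Hypotheses (mM : measurable M) (fM : forall u, ~ M u -> f u = u)
  (muM : mu M = 0%E) (nuM : nu M = 0%E).
Local Notation N := (n.+1 + n.+1)%N.
Local Notation T0 := (d.-tuple R).
Let Pn := tuple_product N (sample_marginal n mu nu).
Let F := sample_cost (n := n) f.
Let E := \int[Pn]_t F t.

Let fmu A : measurable A -> mu (f @^-1` A) = mu A.
Proof. by move=> mA; exact: (law_retraction (g := id) mf _ mM fM muM mA). Qed.

Let fnu A : measurable A -> nu (f @^-1` A) = nu A.
Proof. by move=> mA; exact: (law_retraction (g := id) mf _ mM fM nuM mA). Qed.

Lemma W2sq_le_mean : (W2sq mu nu <= E%:E)%E.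
Proof.
rewrite -EFin_Rintegral_bounded; last exact: bounded_measurable_sample_cost.
have law (m : probability T0 R) (k : 'I_N) A : (forall B, measurable B -> m (f @^-1` B) = m B) ->
    sample_marginal n mu nu k = m -> measurable A ->
    Pn ((fun t => f (tnth t k)) @^-1` A) = m A.
  move=> fm km mA; rewrite -fm// -km; apply: tuple_product_tnth.
  by have := mf measurableT mA; rewrite setTI.
apply: (@W2sq_le_permuted R d n mu nu _ _ Pn
  (fun i t => f (tnth t (lshift n.+1 i))) (fun i t => f (tnth t (rshift n.+1 i)))
  (fun t => optperm (fun i j => sqd (f (tnth t (lshift n.+1 i)))
                                    (f (tnth t (rshift n.+1 j)))))).
- by move=> i; exact: measurable_coordinate.
- by move=> i; exact: measurable_coordinate.
- move=> i A mA; apply: law => //; by rewrite /sample_marginal /= ltn_ord.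
- move=> i A mA; apply: law => //; by rewrite /sample_marginal /= ltnNge leq_addr.
- move=> t; apply: (measurable_optperm (c := fun i j t =>
    sqd (f (tnth t (lshift n.+1 i))) (f (tnth t (rshift n.+1 j))))) => i j.
  by apply: measurable_sqd_comp; exact: measurable_coordinate.
Qed.

Lemma W2sq_ge0 : (0 <= W2sq mu nu)%E.
Proof.
apply: le_ereal_inf_tmp => _ [g _ <-]; apply: integral_ge0 => z _.
by rewrite lee_fin sqr_ge0.
Qed.

Lemma W2sq_fin_num : W2sq mu nu \is a fin_num.
Proof.
by rewrite ge0_fin_numE ?W2sq_ge0// (le_lt_trans W2sq_le_mean)// ltry.
Qed.

(** Under a coupling both components avoid the null set [M] almost surely, by the marginal
    conditions, so [f] leaves the cost unchanged. *)
Let retracted_cost (pi : probability (T0 * T0)%type R) : couplings mu nu pi ->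
  (\int[pi]_z sqd (f z.1) (f z.2))%:E = (\int[pi]_z ((l2dist z.1 z.2) ^+ 2)%:E)%E.
Proof.
move=> [p1 p2]; under [RHS]eq_integral do rewrite l2dist_sqr.
have mfst : measurable (fst @^-1` M : set (T0 * T0)%type).
  by have := @measurable_fst _ _ T0 T0 measurableT M mM; rewrite setTI.
have msnd : measurable (snd @^-1` M : set (T0 * T0)%type).
  by have := @measurable_snd _ _ T0 T0 measurableT M mM; rewrite setTI.
have bm : bounded_measurable (fun z : T0 * T0 => sqd (f z.1) (f z.2)).
  split; last by exists 1 => z; rewrite ger0_norm ?sqd_ge0.
  by apply: measurable_sqd_comp; apply: measurableT_comp mf _.
rewrite -EFin_Rintegral_bounded//; apply: ge0_ae_eq_integral => //.
- by apply/measurable_EFinP; case: bm.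
- by apply/measurable_EFinP; exact: measurable_sqd.
- by move=> z _; rewrite lee_fin sqd_ge0.
- by move=> z _; rewrite lee_fin sqd_ge0.
exists (fst @^-1` M `|` snd @^-1` M); split.
- exact: measurableU.
- apply: null_set_setU => //; [exact: etrans (p1 _ mM) muM|exact: etrans (p2 _ mM) nuM].
- move=> z /= h; apply: contrapT => /not_orP[h1 h2]; apply: h => _.
  by rewrite !fM.
Qed.

Lemma mean_le_W2sq K : E <= fine (W2sq mu nu) + 2^-1 * tree_bound R d n K.
Proof.
apply/ler_addgt0Pr => e e0.
(* The cost of [pi] enters the upper bound twice, so near-optimality up to [e / 2] leaves an error
   [e]; the bound [W2sq mu nu <= V] then removes one of the two copies. *)
have e20 : 0 < e / 2 by rewrite divr_gt0.
have [_ [pi cpi <-]] := lb_ereal_inf_adherent e20 W2sq_fin_num.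
rewrite -retracted_cost// -/(W2sq mu nu) -(fineK W2sq_fin_num) -EFinD lte_fin => lt_pi.
have [V] := @lifted_upper_bound R d n d0 f mf f1 mu nu fmu fnu pi cpi K.
rewrite -(fineK W2sq_fin_num) lee_fin -/F -/Pn -/E; lra.
Qed.

Lemma mean_abs_le K :
  (\int[Pn]_t (`|F t - fine (W2sq mu nu)|)%:E <=
    (expR 1 / Num.sqrt n.+1%:R + 2^-1 * tree_bound R d n K)%:E)%E.
Proof.
set w := fine _.
have bF : bounded_measurable F by exact: bounded_measurable_sample_cost.
have bFE (c : R) : bounded_measurable (fun t => `|F t - c|).
  apply: bounded_measurable_norm; apply: bounded_measurableB => //.
  exact: bounded_measurable_cst.
have wE : w <= E.
  by have := W2sq_le_mean; rewrite -(fineK W2sq_fin_num) lee_fin.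
have := subgaussian_mean (ltn0Sn n) (measurable_sample_cost mf)
  (sample_cost_mgf n mf f1 (sample_marginal n mu nu)).
rewrite !EFin_Rintegral_bounded ?lee_fin// => Fmean.
(* Fluctuation plus bias; the bias is nonnegative by [W2sq_le_mean]. *)
apply: (@le_trans _ _ (\int[Pn]_t (`|F t - E| + (E - w)))).
  apply: le_Rintegral_bounded => // [|t].
    by apply: bounded_measurableD => //; exact: bounded_measurable_cst.
  have -> : F t - w = (F t - E) + (E - w) by ring.
  by rewrite (le_trans (ler_normD _ _))// lerD2l ger0_norm// subr_ge0.
rewrite RintegralD_bounded//; last exact: bounded_measurable_cst.
rewrite Rintegral_probability_cst lerD// lerBlDl; exact: mean_le_W2sq.
Qed.

End main.

Theorem theorem2 (R : realType) (d : nat) (hd : (1 <= d)%N) :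
  exists C : R,
  forall (S : set (d.-tuple R)) (mu nu : probability (d.-tuple R) R),
    diameter S = 1%E ->
    supported_on mu S ->
    supported_on nu S ->
  forall (dO : measure_display) (Omega : measurableType dO)
    (P : probability Omega R) (n : nat)
    (X Y : 'I_n -> {RV P >-> d.-tuple R}),
    (1 <= n)%N ->
    (forall i, has_law P (X i) mu) ->
    (forall i, has_law P (Y i) nu) ->
    mutually_independent P (joint_family X Y) ->
  let W (w : Omega) : \bar R :=
    W2sq (empirical (fun i => X i w)) (empirical (fun i => Y i w)) in
  ((d = 4%N -> (2 <= n)%N) ->
     (\int[P]_w `| W w - W2sq mu nu | <= (C * rate R d n)%:E)%E)
  /\
  (forall t : R, 0 <= t ->
     (P [set w | t%:E <= `| W w - \int[P]_w' W w' |]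
        <= (2 * expR (- (n%:R * t ^+ 2)))%:E)%E).
Proof.
have [C C0 HC] := tree_rate R hd.
(* The fluctuation has coefficient [expR 1] and the bias [2^-1]; both are at most [expR 1]. *)
exists (expR 1 * C) => S mu nu S1 muS nuS dO Omega P [//|n] X Y _ lawX lawY indXY W.
have [f [M [mf mM f1 fM [muM nuM]]]] := support_retraction S1 muS nuS.
pose N := (n.+1 + n.+1)%N.
pose Pn := tuple_product N (sample_marginal n mu nu).
pose F := sample_cost (n := n) f.
pose E := \int[Pn]_t F t.
pose Z := pooled_sample X Y.
have mZ := measurable_pooled_sample X Y.
have PZ := pooled_sample_independent lawX lawY indXY.
pose T w := [tuple Z k w | k < N].
(* [G] is the cost of the actual sample and [F] that of the retracted one. They coincide on [good],
   whose complement is null. *)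
pose G := sample_cost (R := R) (d := d) (n := n) idfun.
have Zl i w : tnth (T w) (lshift n.+1 i) = X i w.
  by rewrite tnth_mktuple /Z /pooled_sample -[lshift _ _]/(unsplit (inl i)) unsplitK.
have Zr i w : tnth (T w) (rshift n.+1 i) = Y i w.
  by rewrite tnth_mktuple /Z /pooled_sample -[rshift _ _]/(unsplit (inr i)) unsplitK.
have WG w : W w = (G (T w))%:E.
  rewrite /W W2sq_empirical -/(empirical_cost _ _) /G /sample_cost /=.
  by rewrite (funext (fun i => Zl i w)) (funext (fun i => Zr i w)).
have mG : measurable_fun setT G.
  by apply: measurable_sample_cost; exact: measurable_id.
have mF : measurable_fun setT F by exact: measurable_sample_cost.
have G0 t : 0 <= G t by exact: empirical_cost_ge0.
have F0 t : 0 <= F t by exact: empirical_cost_ge0.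
pose good := @tuple_rect _ (d.-tuple R) N (fun=> ~` M).
have mgood : measurable good.
  by apply: measurable_tuple_rect => _; exact: measurableC.
have bad0 : Pn (~` good) = 0%E.
  rewrite probability_setC// /Pn tuple_product_rect; last by move=> _; exact: measurableC.
  rewrite big1 ?subee// => k _; rewrite probability_setC//.
  by rewrite /sample_marginal; case: ifP => _; rewrite ?muM ?nuM sube0.
have GF t : good t -> G t = F t.
  move=> gt; rewrite /G /F /sample_cost.
  have ft k : idfun (tnth t k) = f (tnth t k) by rewrite fM//; exact: gt.
  by rewrite (funext (fun i => ft (lshift n.+1 i))) (funext (fun i => ft (rshift n.+1 i))).
have transfer (H : R -> R) : measurable_fun setT H -> (forall r, 0 <= H r) ->
    (\int[P]_w (H (G (T w)))%:E = \int[Pn]_t (H (F t))%:E)%E.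
  move=> mH H0.
  have mHG : measurable_fun setT (fun t => (H (G t))%:E).
    by apply/measurable_EFinP; exact: measurableT_comp mH mG.
  rewrite (sample_integral mZ PZ mHG); last by move=> t; rewrite lee_fin.
  apply: ge0_ae_eq_integral => //.
  - by apply/measurable_EFinP; exact: measurableT_comp mH mF.
  - by move=> t _; rewrite lee_fin.
  - by move=> t _; rewrite lee_fin.
  exists (~` good); split => //; first exact: measurableC.
  by move=> t h gt; apply: h => _; rewrite GF.
split=> [d4|t t0].
  have [K HK] := HC n.+1 (ltn0Sn n) d4.
  set w0 := fine (W2sq mu nu).
  have w0E : W2sq mu nu = w0%:E.
    by rewrite fineK//; exact: (W2sq_fin_num n mf f1 mM fM muM nuM).
  rewrite w0E; under eq_integral do rewrite WG -EFinB abse_EFin.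
  rewrite (transfer (fun r => `|r - w0|))//; last first.
    by apply: measurableT_comp => //; apply: measurable_funB.
  apply: (le_trans (mean_abs_le n hd mf f1 mM fM muM nuM K)).
  rewrite lee_fin -mulrA (le_trans _ (ler_wpM2l (expR_ge0 1) HK))//.
  rewrite /tree_bound; set B := \sum_(k < K) _.
  have B0 : 0 <= cell_diam2 R d K + n.+1%:R^-1 * B.
    rewrite addr_ge0//.
      by rewrite mulr_ge0// invr_ge0 exprn_ge0.
    rewrite mulr_ge0// ?invr_ge0// sumr_ge0// => k _.
    by rewrite mulr_ge0 ?sqrtr_ge0// ltW// cell_weight_gt0.
  rewrite -(addrA _ (cell_diam2 R d K)) [leRHS]mulrDr lerD2l ler_wpM2r//.
  by have := expR_ge1Dx (1 : R); lra.
have bF : bounded_measurable F by exact: bounded_measurable_sample_cost.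
have EW : (\int[P]_w' W w' = E%:E)%E.
  rewrite /E -EFin_Rintegral_bounded//.
  (* [transfer] is stated for functions that are nonnegative on all of [R], so the nonnegative cost
     is written as its absolute value. *)
  rewrite (eq_integral (fun w => (`|G (T w)|)%:E)); last first.
    by move=> w _; rewrite WG ger0_norm.
  rewrite (transfer (fun r => `|r|))//; apply: eq_integral => u _.
  by rewrite ger0_norm.
rewrite EW.
have mdev (H : N.-tuple (d.-tuple R) -> R) : measurable_fun setT H ->
    measurable [set u | t <= `|H u - E|].
  move=> mH; have mHE : measurable_fun setT (fun u => `|H u - E|).
    by apply: measurableT_comp => //; exact: measurable_funB.
  have := @measurable_fun_ler _ _ R setT (cst t) _ (measurable_cst t) mHE
    measurableT [set true].
  by rewrite setTI; apply.
rewrite (_ : [set w | _] = T @^-1` [set u | t <= `|G u - E|]); last first.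
  by apply/seteqP; split=> w /=; rewrite WG -EFinB abse_EFin lee_fin.
rewrite (sample_law mZ PZ (mdev G mG)).
have : Pn [set u | t <= `|G u - E|] = Pn [set u | t <= `|F u - E|].
  rewrite -(probability_setI_full (mdev G mG) mgood bad0).
  rewrite -(probability_setI_full (mdev F mF) mgood bad0); congr (Pn _).
  by apply/seteqP; split=> u /= [hu gu]; split => //; move: hu; rewrite GF.
move=> ->; exact: (subgaussian_tail (ltn0Sn n) mF (sample_cost_mgf n mf f1 _) t0).
Qed.
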